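(* Let $\mathcal Z$ be a finite nonempty zero-set. For every $\alpha,\beta\ge0$ the large deviation rate $I(\alpha,\beta,\mathcal Z)$ exists. Moreover there is a finite set $\mathcal A_0$ of finite spanning sets, depending only on $\mathcal Z$ (not on $\alpha,\beta$), such that $$I(\alpha,\beta,\mathcal Z)=\inf\{\rho(\alpha,\beta,A):A\in\mathcal A\}=\min\{\rho(\alpha,\beta,A):A\in\mathcal A_0\},$$ where $\mathcal A$ is the set of all finite spanning sets. As a function of $(\alpha,\beta)$, $I(\cdot,\cdot,\mathcal Z)$ is continuous, piecewise linear, nonincreasing in each argument, concave on $\{\alpha+\beta\le1\}$, and $I(0,0,\mathcal Z)=\gamma(\mathcal Z)>I(\alpha,\beta,\mathcal Z)$ whenever $(\alpha,\beta)\ne(0,0)$. Furthermore, the support of $I(\cdot,\cdot,\mathcal Z)$ in $[0,1]^2$ (the closure of the set where $I>0$) is $$\bigcap_{(u,v)\in\partial_o\mathcal Z}\{(\alpha,\beta)\in[0,1]^2:[u(1-\alpha)-\beta]\vee[v(1-\beta)-\alpha]\ge0\},$$ and if $(\alpha,\beta)\in[0,1]^2$ lies outside this support then $P_p(\mathrm{Span})\to1$ as $p\to0$.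
   Context: Let $\mathbb Z_+=\{0,1,2,\dots\}$, $R_{a,b}=([0,a-1]\times[0,b-1])\cap\mathbb Z_+^2$. A (discrete) zero-set is a set $\mathcal Z\subseteq\mathbb Z_+^2$ that is a union of rectangles $R_{a,b}$. For $A\subseteq\mathbb Z_+^2$, $x\in\mathbb Z_+^2$, $\mathrm{row}(x,A)$ (resp. $\mathrm{col}(x,A)$) is the number of points of $A$ on the horizontal (resp. vertical) line through $x$; the neighborhood growth transformation is $\mathcal T(A)=A\cup\{x\notin A:(\mathrm{row}(x,A),\mathrm{col}(x,A))\notin\mathcal Z\}$; $A$ spans if $\bigcup_t\mathcal T^t(A)=\mathbb Z_+^2$; $\gamma(\mathcal Z)$ is the minimum size of a finite spanning set. Large deviation setting: fix $\alpha,\beta\ge0$; as $p\to0$ let integers $N,M\to\infty$ with $\log N\sim-\alpha\log p$, $\log M\sim-\beta\log p$; the initial set $\omega_0$ contains each point of $R_{N,M}$ independently with probability $p$ (and no other points); $\mathrm{Span}$ is the event that $\omega_0$ spans; $I(\alpha,\beta,\mathcal Z)=\lim_{p\to0}\log P_p(\mathrm{Span})/\log p$ when the limit exists. For finite $A$, $\pi_x(A),\pi_y(A)$ are its projections onto the axes and $\rho(\alpha,\beta,A)=\max_{B\subseteq A}(|B|-\alpha|\pi_x(B)|-\beta|\pi_y(B)|)$. The outer boundary of a Young diagram $Y$ is $\partial_oY=\{(u,v)\in\mathbb Z_+^2\setminus Y:(u-1,v)\in Y\text{ or }(u,v-1)\in Y\}$; $a\vee b=\max(a,b)$. *)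

(* Defs.v *)
From Stdlib Require Import Reals Lra Lia List Arith Classical ClassicalEpsilon.
Import ListNotations.
Open Scope R_scope.

Definition pt := (nat * nat)%type.

Definition inRect (a b : nat) (x : pt) : Prop := (fst x < a)%nat /\ (snd x < b)%nat.

Definition is_zero_set (Z : pt -> Prop) : Prop :=
  forall x, Z x -> exists a b, inRect a b x /\ (forall y, inRect a b y -> Z y).

Definition finite_set (Z : pt -> Prop) : Prop :=
  exists l : list pt, forall x, Z x <-> In x l.

(** row(x,A) >= k : at least k distinct points of A on the horizontal line
    through x (same second coordinate); col similarly (same first coordinate).
    Phrased as lower bounds so that infinite A (possible after iteration) is
    handled: an infinite count exceeds every k. *)
Definition row_ge (A : pt -> Prop) (x : pt) (k : nat) : Prop :=
  exists l : list pt, length l = k /\ NoDup l /\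
    forall y, In y l -> A y /\ snd y = snd x.
Definition col_ge (A : pt -> Prop) (x : pt) (k : nat) : Prop :=
  exists l : list pt, length l = k /\ NoDup l /\
    forall y, In y l -> A y /\ fst y = fst x.

(** Neighborhood growth transformation. Since Z is down-closed,
    (row(x,A),col(x,A)) \notin Z  iff  some (r,c) \notin Z has
    row(x,A) >= r and col(x,A) >= c (with infinite counts allowed). *)
Definition T (Z : pt -> Prop) (A : pt -> Prop) : pt -> Prop :=
  fun x => A x \/ (~ A x /\ exists r c, ~ Z (r, c) /\ row_ge A x r /\ col_ge A x c).

Fixpoint Titer (Z : pt -> Prop) (A : pt -> Prop) (t : nat) : pt -> Prop :=
  match t with
  | O => A
  | S t' => T Z (Titer Z A t')
  end.

Definition spans (Z : pt -> Prop) (A : pt -> Prop) : Prop :=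
  forall x, exists t, Titer Z A t x.

Definition fin_spanning (Z : pt -> Prop) (A : list pt) : Prop :=
  NoDup A /\ spans Z (fun x => In x A).

Definition gamma_spec (Z : pt -> Prop) (g : nat) : Prop :=
  (exists A, fin_spanning Z A /\ length A = g) /\
  (forall A, fin_spanning Z A -> (g <= length A)%nat).

Fixpoint sublists {X : Type} (l : list X) : list (list X) :=
  match l with
  | [] => [[]]
  | x :: l' => let s := sublists l' in s ++ map (cons x) s
  end.

Definition rho (alpha beta : R) (A : list pt) : R :=
  fold_right Rmax 0
    (map (fun B => INR (length B)
                   - alpha * INR (length (nodup Nat.eq_dec (map fst B)))
                   - beta * INR (length (nodup Nat.eq_dec (map snd B))))
         (sublists A)).

Definition indic (P : Prop) : R :=
  if excluded_middle_informative P then 1 else 0.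

Definition grid (N M : nat) : list pt := list_prod (seq 0 N) (seq 0 M).

Definition Pspan (Z : pt -> Prop) (N M : nat) (p : R) : R :=
  fold_right Rplus 0
    (map (fun S => p ^ length S * (1 - p) ^ (N * M - length S)
                   * indic (spans Z (fun x => In x S)))
         (sublists (grid N M))).

Definition lim0 (f : R -> R) (L : R) : Prop :=
  forall eps, eps > 0 -> exists delta, delta > 0 /\
    forall p, 0 < p < delta -> Rabs (f p - L) < eps.

Definition to_infty0 (N : R -> nat) : Prop :=
  forall K : nat, exists delta, delta > 0 /\
    forall p, 0 < p < delta -> (K <= N p)%nat.

Definition ld_regime (alpha beta : R) (N M : R -> nat) : Prop :=
  to_infty0 N /\ to_infty0 M /\
  lim0 (fun p => ln (INR (N p)) / ln p) (- alpha) /\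
  lim0 (fun p => ln (INR (M p)) / ln p) (- beta).

Definition rate_is (Z : pt -> Prop) (alpha beta L : R) : Prop :=
  forall N M, ld_regime alpha beta N M ->
    lim0 (fun p => ln (Pspan Z (N p) (M p) p) / ln p) L.

Definition outer_boundary (Z : pt -> Prop) (q : pt) : Prop :=
  ~ Z q /\
  ((exists u', fst q = S u' /\ Z (u', snd q)) \/
   (exists v', snd q = S v' /\ Z (fst q, v'))).

Definition quadrant (a b : R) : Prop := 0 <= a /\ 0 <= b.
Definition unit_square (a b : R) : Prop := 0 <= a <= 1 /\ 0 <= b <= 1.

Definition continuous_quadrant (f : R -> R -> R) : Prop :=
  forall a b, quadrant a b -> forall eps, eps > 0 -> exists delta, delta > 0 /\
    forall a' b', quadrant a' b' -> Rabs (a' - a) < delta -> Rabs (b' - b) < delta ->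
      Rabs (f a' b' - f a b) < eps.

(** Piecewise linear on the quadrant: continuous (stated separately) and at
    every point equal to one of finitely many affine functions. *)
Definition piecewise_linear_quadrant (f : R -> R -> R) : Prop :=
  exists L : list (R * R * R), forall a b, quadrant a b ->
    exists c, In c L /\
      f a b = fst (fst c) + snd (fst c) * a + snd c * b.

Definition concave_on_triangle (f : R -> R -> R) : Prop :=
  forall a1 b1 a2 b2 t,
    quadrant a1 b1 -> a1 + b1 <= 1 -> quadrant a2 b2 -> a2 + b2 <= 1 ->
    0 <= t <= 1 ->
    t * f a1 b1 + (1 - t) * f a2 b2 <= f (t * a1 + (1 - t) * a2) (t * b1 + (1 - t) * b2).

Definition support_unit (f : R -> R -> R) (a b : R) : Prop :=
  forall eps, eps > 0 -> exists a' b', unit_square a' b' /\ f a' b' > 0 /\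
    Rabs (a' - a) < eps /\ Rabs (b' - b) < eps.

Definition predicted_support (Z : pt -> Prop) (a b : R) : Prop :=
  unit_square a b /\
  forall q, outer_boundary Z q ->
    Rmax (INR (fst q) * (1 - a) - b) (INR (snd q) * (1 - b) - a) >= 0.

(* Main.v *)
(** Lines (rows and columns) may be permuted freely, and a line with many points fills up.
    Between two consecutive fillings of a line only boundedly many points can become occupied,
    so a spanning configuration occupies everything within a time bounded in terms of [Z]; hence
    it contains a spanning subset of bounded size, and up to relabelling of lines there are only
    finitely many of these. The upper bound on [P(Span)] is then a union bound over these
    patterns, each estimated by the expected number of copies of its costliest subpattern, and
    the lower bound is the second moment method for the number of copies of one pattern. So the
    rate is a minimum of finitely many functions [rho], each a maximum of affine functions.
    If [rho] of a set vanishes while all boundary inequalities are strict, the set does not grow;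
    if both inequalities fail at [(u, v)], many rows with [u] points and many columns with [v]
    points occur with high probability, and their crossings fill up. *)
Require Import Defs.
From Stdlib Require Import Reals Lra Lia List Arith Classical ClassicalEpsilon Permutation.
Import ListNotations.
Open Scope nat_scope.

(** * Growth dynamics *)

(** The finite family is [small_spanning Z K], all spanning subsets of the [K] by [K] grid, where
    [K] bounds the size of some spanning subset of every spanning set and so the number of lines it
    meets. The parameters alpha and beta enter only through [rho]. A pattern with [n] points, [c]
    columns and [r] rows has about [N^c * M^r * p^n], that is [p^val], expected copies, so [rho] is
    the exponent of its rarest subpattern. Arbitrary choices of lines could collide or overlap
    awkwardly. Cutting the rectangle into blocks, one per line of the pattern, makes every choice an
    injective copy, and two copies then share only images of the same point. The loss is a constant
    factor in [N] and [M], invisible after dividing logarithms by [ln p]. In the normalised second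
    moment an overlap contributes at most about [p^(-val)], so the exponent is at most [rho] and
    matches the first moment. The same estimate gives probability tending to 1 when every nonempty
    subpattern has negative [val]: only the term without coincidences survives, and it equals 1. *)

Lemma pt_eq_dec (x y : pt) : {x = y} + {x <> y}.
Proof. decide equality; apply Nat.eq_dec. Defined.

Definition bounded_by (k : nat) (Z : pt -> Prop) : Prop :=
  forall r c, Z (r, c) -> r < k /\ c < k.

Lemma length_grid N M : length (grid N M) = N * M.
Proof. etransitivity; [apply length_prod | now rewrite !length_seq]. Qed.

Lemma in_grid N M x y : In (x, y) (grid N M) <-> x < N /\ y < M.
Proof. unfold grid. rewrite in_prod_iff, !in_seq. lia. Qed.

Lemma finite_bounded Z : finite_set Z -> exists k, bounded_by k Z.
Proof.
  intros [l Hl].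
  exists (S (list_max (map fst l) + list_max (map snd l))).
  intros r c H. apply Hl in H.
  assert (H1 := proj1 (list_max_le (map fst l) _) (Nat.le_refl _)).
  assert (H2 := proj1 (list_max_le (map snd l) _) (Nat.le_refl _)).
  rewrite Forall_forall in H1, H2.
  specialize (H1 r (in_map fst _ _ H)). specialize (H2 c (in_map snd _ _ H)). lia.
Qed.

Lemma row_ge_mono A B x y r r' :
  (forall z, A z -> B z) -> snd x = snd y -> r' <= r ->
  row_ge A x r -> row_ge B y r'.
Proof.
  intros HAB Hxy Hr (l & Hl & Hn & Hin).
  exists (firstn r' l). repeat split.
  - rewrite length_firstn. lia.
  - rewrite <- (firstn_skipn r' l) in Hn. now apply NoDup_app_remove_r in Hn.
  - apply HAB, Hin. rewrite <- (firstn_skipn r' l). apply in_or_app. now left.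
  - rewrite <- Hxy. apply Hin. rewrite <- (firstn_skipn r' l). apply in_or_app. now left.
Qed.

Lemma col_ge_mono A B x y c c' :
  (forall z, A z -> B z) -> fst x = fst y -> c' <= c ->
  col_ge A x c -> col_ge B y c'.
Proof.
  intros HAB Hxy Hr (l & Hl & Hn & Hin).
  exists (firstn c' l). repeat split.
  - rewrite length_firstn. lia.
  - rewrite <- (firstn_skipn c' l) in Hn. now apply NoDup_app_remove_r in Hn.
  - apply HAB, Hin. rewrite <- (firstn_skipn c' l). apply in_or_app. now left.
  - rewrite <- Hxy. apply Hin. rewrite <- (firstn_skipn c' l). apply in_or_app. now left.
Qed.

Lemma row_ge_0 A x : row_ge A x 0.
Proof. exists []. repeat split; [constructor | contradiction | contradiction]. Qed.

Lemma col_ge_0 A x : col_ge A x 0.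
Proof. exists []. repeat split; [constructor | contradiction | contradiction]. Qed.

Lemma row_ge_intro (A : pt -> Prop) i j l r :
  NoDup l -> r <= length l -> (forall a, In a l -> A (a, j)) -> row_ge A (i, j) r.
Proof.
  intros Hn Hr Hin.
  apply (row_ge_mono A A (i, j) (i, j) (length l)); auto.
  exists (map (fun a => (a, j)) l). rewrite length_map. repeat split.
  - apply FinFun.Injective_map_NoDup; auto. intros a b H. congruence.
  - apply in_map_iff in H. destruct H as (a & <- & Ha). auto.
  - apply in_map_iff in H. destruct H as (a & <- & Ha). auto.
Qed.

Lemma col_ge_intro (A : pt -> Prop) i j l c :
  NoDup l -> c <= length l -> (forall b, In b l -> A (i, b)) -> col_ge A (i, j) c.
Proof.
  intros Hn Hr Hin.
  apply (col_ge_mono A A (i, j) (i, j) (length l)); auto.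
  exists (map (fun b => (i, b)) l). rewrite length_map. repeat split.
  - apply FinFun.Injective_map_NoDup; auto. intros a b H. congruence.
  - apply in_map_iff in H. destruct H as (a & <- & Ha). auto.
  - apply in_map_iff in H. destruct H as (a & <- & Ha). auto.
Qed.

Lemma T_intro Z A x r c :
  ~ Z (r, c) -> row_ge A x r -> col_ge A x c -> T Z A x.
Proof.
  intros. destruct (classic (A x)); [now left | right; split; auto; now exists r, c].
Qed.

(** Counts above [k] can be cut to [k], because a pair with a coordinate equal to [k] lies outside
    [Z] anyway. This leaves finitely many triggers and bounds the number of points on which one new
    point depends. *)
Lemma T_elim k Z A x :
  bounded_by k Z -> T Z A x ->
  A x \/ exists r c, r <= k /\ c <= k /\ ~ Z (r, c) /\ row_ge A x r /\ col_ge A x c.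
Proof.
  intros Hk [H | (_ & r & c & Hz & Hr & Hc)]; [now left | right].
  exists (Nat.min r k), (Nat.min c k). repeat split; try lia.
  - intros Hz'. destruct (Hk _ _ Hz'). apply Hz.
    now rewrite !Nat.min_l in Hz' by lia.
  - apply (row_ge_mono A A x x r); auto; lia.
  - apply (col_ge_mono A A x x c); auto; lia.
Qed.

Lemma T_mono Z A B x : (forall y, A y -> B y) -> T Z A x -> T Z B x.
Proof.
  intros H [Hx | (_ & r & c & Hz & Hr & Hc)]; [left; auto |].
  apply (T_intro Z B x r c); auto.
  - now apply (row_ge_mono A B x x r).
  - now apply (col_ge_mono A B x x c).
Qed.

Lemma Titer_mono Z A B t x :
  (forall y, A y -> B y) -> Titer Z A t x -> Titer Z B t x.
Proof.
  intros H. revert x. induction t as [|t IH]; simpl; auto.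
  intros x. now apply T_mono.
Qed.

Lemma Titer_le Z A s t x : s <= t -> Titer Z A s x -> Titer Z A t x.
Proof. induction 1; auto. intros. simpl. left. auto. Qed.

Lemma Titer_add Z A s t x : Titer Z A (s + t) x <-> Titer Z (Titer Z A t) s x.
Proof.
  revert x. induction s as [|s IH]; simpl; [tauto |].
  intros x. split; apply T_mono; intros; now apply IH.
Qed.

Lemma spans_mono Z A B : (forall y, A y -> B y) -> spans Z A -> spans Z B.
Proof. intros H HA x. destruct (HA x) as [t Ht]. exists t. now apply (Titer_mono Z A). Qed.

Lemma Titer_stationary Z A :
  (forall x, T Z A x -> A x) -> forall t x, Titer Z A t x -> A x.
Proof.
  intros H t. induction t as [|t IH]; simpl; auto.
  intros x Hx. apply H. now apply (T_mono Z (Titer Z A t)).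
Qed.

Lemma spans_Titer Z A t : spans Z A -> spans Z (Titer Z A t).
Proof. apply spans_mono. intros y Hy. now apply (Titer_le Z A 0 t); [lia |]. Qed.

Lemma spans_of_Titer Z A t : spans Z (Titer Z A t) -> spans Z A.
Proof. intros H x. destruct (H x) as [s Hs]. exists (s + t). now apply Titer_add. Qed.

(** * Full lines and a uniform bound on the spanning time *)

Definition row_full (A : pt -> Prop) (j : nat) : Prop := forall i, A (i, j).
Definition col_full (A : pt -> Prop) (i : nat) : Prop := forall j, A (i, j).

Lemma row_full_T k Z A i j : bounded_by k Z -> row_ge A (i, j) k -> row_full (T Z A) j.
Proof.
  intros Hk H i'. apply (T_intro Z A _ k 0).
  - intros Hz. apply Hk in Hz. lia.
  - now apply (row_ge_mono A A (i, j) (i', j) k).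
  - apply col_ge_0.
Qed.

Lemma col_full_T k Z A i j : bounded_by k Z -> col_ge A (i, j) k -> col_full (T Z A) i.
Proof.
  intros Hk H j'. apply (T_intro Z A _ 0 k).
  - intros Hz. apply Hk in Hz. lia.
  - apply row_ge_0.
  - now apply (col_ge_mono A A (i, j) (i, j') k).
Qed.

Lemma full_rows_T k Z A l :
  bounded_by k Z -> NoDup l -> k <= length l -> (forall j, In j l -> row_full A j) ->
  forall x, T Z A x.
Proof.
  intros Hk Hn Hl Hf [i j]. apply (col_full_T k Z A i 0 Hk).
  apply (col_ge_intro A i 0 l k); auto. intros b Hb. now apply Hf.
Qed.

Lemma full_cols_T k Z A l :
  bounded_by k Z -> NoDup l -> k <= length l -> (forall i, In i l -> col_full A i) ->
  forall x, T Z A x.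
Proof.
  intros Hk Hn Hl Hf [i j]. apply (row_full_T k Z A 0 j Hk).
  apply (row_ge_intro A 0 j l k); auto. intros b Hb. now apply Hf.
Qed.

(** [k] occupied points fill a row in one step, and [k] full rows fill every column in the next. The
    square thus serves as a finite certificate of spanning. *)
Lemma spans_block k Z A :
  bounded_by k Z -> (forall i j, i < k -> j < k -> A (i, j)) -> spans Z A.
Proof.
  intros Hk H x. exists 2. simpl.
  apply (full_rows_T k Z _ (seq 0 k)); auto using seq_NoDup.
  - now rewrite length_seq.
  - intros j Hj. apply in_seq in Hj. apply (row_full_T k Z A 0 j Hk).
    apply (row_ge_intro A 0 j (seq 0 k)); auto using seq_NoDup.
    + now rewrite length_seq.
    + intros a Ha. apply in_seq in Ha. apply H; lia.
Qed.

Lemma pigeonhole {X Y : Type} (dec : forall x y : Y, {x = y} + {x <> y})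
    (f : X -> Y) (keys : list Y) (q : nat) (l : list X) :
  (forall s, In s l -> In (f s) keys) -> length keys * q < length l ->
  exists y, q < length (filter (fun s => if dec (f s) y then true else false) l).
Proof.
  revert l. induction keys as [|y keys IH]; intros l Hin Hlen.
  - destruct l as [|s l]; simpl in *; [lia | destruct (Hin s); auto].
  - set (g := fun s => if dec (f s) y then true else false).
    destruct (le_lt_dec (length (filter g l)) q) as [Hq|Hq]; [|now exists y].
    assert (Hsum := filter_length g l). simpl in Hlen.
    destruct (IH (filter (fun s => negb (g s)) l)) as [y' Hy'].
    + intros s Hs. apply filter_In in Hs. destruct Hs as [Hs Hg].
      unfold g in Hg. destruct (Hin s Hs) as [->|]; auto.
      destruct (dec (f s) (f s)); [discriminate | congruence].
    + lia.
    + exists y'.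
      eapply Nat.lt_le_trans; [exact Hy' |].
      clear. induction l as [|s l IHl]; simpl; auto.
      destruct (g s); simpl; destruct (dec (f s) y'); simpl; lia.
Qed.

Lemma list_maximum (l : list nat) : l <> [] -> exists m, In m l /\ forall s, In s l -> s <= m.
Proof.
  induction l as [|a l IH]; [congruence | intros _].
  destruct l as [|b l]; [exists a; split; [now left | intros s [->|[]]; auto] |].
  destruct IH as (m & Hm & Hmax); [discriminate |].
  destruct (le_lt_dec a m).
  - exists m. split; [now right | intros s [<-|Hs]; auto].
  - exists a. split; [now left | intros s [<-|Hs]; auto]. apply Hmax in Hs. lia.
Qed.

(** Pigeonhole count: [(k+1)^2] triggers with both counts at most [k], each allowed [k^2] points,
    and one step more. *)
Definition lag (k : nat) : nat := S ((S k * S k) * (k * k)).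

(* Every newly occupied point is triggered by some (r, c) with r, c <= k. If more
   than k^2 points share the same trigger, they meet at least k rows or columns, and
   the last of them then sees a whole line of its row or column being occupied. *)
Lemma new_full_line k Z A :
  bounded_by k Z -> spans Z A ->
  (forall x, Titer Z A (lag k) x) \/
  (exists j, ~ row_full A j /\ row_full (Titer Z A (lag k + 2)) j) \/
  (exists i, ~ col_full A i /\ col_full (Titer Z A (lag k + 2)) i).
Proof.
  intros Hk Hsp.
  (* A step that adds nothing makes the configuration stationary, so by spanning it is already
     everything. Otherwise each of the first [lag k] steps supplies a new point. *)
  destruct (classic (exists s, s < lag k /\
     forall x, Titer Z A (S s) x -> Titer Z A s x)) as [(s & Hs & Hst)|Hno].
  { left. intros x. apply (Titer_le Z A s); [lia |].
    destruct (spans_Titer Z A s Hsp x) as [t Ht].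
    exact (Titer_stationary Z _ Hst t x Ht). }
  right.
  assert (Hnew : forall s, exists w : pt * (nat * nat), s < lag k ->
    ~ Titer Z A s (fst w) /\ Titer Z A (S s) (fst w) /\
    fst (snd w) <= k /\ snd (snd w) <= k /\ ~ Z (snd w) /\
    row_ge (Titer Z A s) (fst w) (fst (snd w)) /\
    col_ge (Titer Z A s) (fst w) (snd (snd w))).
  { intros s. destruct (le_lt_dec (lag k) s) as [Hs|Hs].
    { exists ((0,0),(0,0)). lia. }
    destruct (classic (exists x, Titer Z A (S s) x /\ ~ Titer Z A s x)) as [(x & H1 & H2)|Hn].
    - assert (H1' := H1). destruct (T_elim k Z _ x Hk H1') as [|(r & c & ?)]; [contradiction |].
      exists (x, (r, c)). simpl. intros _. tauto.
    - exfalso. apply Hno. exists s. split; auto. intros x Hx.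
      apply NNPP. intros Hx'. apply Hn. now exists x. }
  set (F := fun s => proj1_sig (constructive_indefinite_description _ (Hnew s))).
  assert (HF : forall s, s < lag k -> 
    ~ Titer Z A s (fst (F s)) /\ Titer Z A (S s) (fst (F s)) /\
    fst (snd (F s)) <= k /\ snd (snd (F s)) <= k /\ ~ Z (snd (F s)) /\
    row_ge (Titer Z A s) (fst (F s)) (fst (snd (F s))) /\
    col_ge (Titer Z A s) (fst (F s)) (snd (snd (F s)))).
  { intros s. exact (proj2_sig (constructive_indefinite_description _ (Hnew s))). }
  clearbody F.
  destruct (pigeonhole pt_eq_dec (fun s => snd (F s))
     (grid (S k) (S k)) (k * k) (seq 0 (lag k))) as [[r c] Hrc].
  { intros s Hs. apply in_seq in Hs. destruct (HF s) as (_ & _ & H1 & H2 & _); [lia |].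
    destruct (snd (F s)) as [r c]. apply in_grid. simpl in H1, H2. lia. }
  { rewrite length_grid, length_seq. unfold lag. lia. }
  set (l := filter _ _) in Hrc.
  assert (Hl : forall s, In s l -> s < lag k /\ snd (F s) = (r, c)).
  { intros s Hs. apply filter_In in Hs. destruct Hs as [Hs1 Hs2]. apply in_seq in Hs1.
    destruct (pt_eq_dec (snd (F s)) (r, c)); [|discriminate]. split; auto. lia. }
  assert (Hnd : NoDup l) by (apply NoDup_filter, seq_NoDup).
  clearbody l.
  destruct (list_maximum l) as (m & Hm & Hmax); [destruct l; simpl in *; [lia | discriminate] |].
  set (pts := map (fun s => fst (F s)) l).
  assert (Hpts : NoDup pts).
  { apply FinFun.Injective_map_NoDup_in; auto.
    assert (Hlt : forall a b, In a l -> In b l -> a < b -> fst (F a) <> fst (F b)).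
    { intros a b Ha Hb Hab E.
      destruct (HF a) as (_ & H1 & _); [now apply Hl |].
      destruct (HF b) as (H2 & _); [now apply Hl |].
      apply H2. rewrite <- E. now apply (Titer_le Z A (S a)). }
    intros a b Ha Hb E. destruct (Nat.lt_total a b) as [H|[H|H]]; auto.
    - now apply Hlt in H.
    - apply Hlt in H; auto. congruence. }
  (* Counts only grow, so at the last time [m] with this trigger every collected point sees [r] in
     its row and [c] in its column. *)
  assert (Hpt : forall x, In x pts ->
     row_ge (Titer Z A m) x r /\ col_ge (Titer Z A m) x c).
  { intros x Hx. apply in_map_iff in Hx. destruct Hx as (s & <- & Hs).
    destruct (Hl s Hs) as [H1 H2]. destruct (HF s H1) as (_ & _ & _ & _ & _ & Hr & Hc).
    rewrite H2 in Hr, Hc. simpl in Hr, Hc. specialize (Hmax s Hs).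
    split.
    - apply (row_ge_mono (Titer Z A s) _ (fst (F s)) _ r); auto.
      intros z. now apply Titer_le.
    - apply (col_ge_mono (Titer Z A s) _ (fst (F s)) _ c); auto.
      intros z. now apply Titer_le. }
  destruct (Hl m Hm) as [Hmk Hmrc].
  destruct (HF m Hmk) as (HmA & _ & _ & _ & HmZ & Hmr & Hmc).
  rewrite Hmrc in HmZ, Hmr, Hmc. simpl in Hmr, Hmc.
  set (xs := nodup Nat.eq_dec (map fst pts)). set (ys := nodup Nat.eq_dec (map snd pts)).
  assert (Hlen : length pts <= length xs * length ys).
  { etransitivity; [|apply Nat.eq_le_incl, length_prod]. apply NoDup_incl_length; auto.
    intros [x y] H. apply in_prod_iff. unfold xs, ys. rewrite !nodup_In.
    split; [now apply (in_map fst) in H | now apply (in_map snd) in H]. }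
  unfold pts in Hlen at 1. rewrite length_map in Hlen.
  destruct (F m) as [[i j] w]. cbn [fst snd] in HmA, Hmr, Hmc.
  destruct (le_lt_dec k (length xs)) as [Hx|Hx].
  - left. exists j. split.
    { intros Hfull. apply HmA. apply (Titer_le Z A 0); [lia |]. apply Hfull. }
    (* The crossing of row [j] with the column of a collected point gets [r] from the row of the
       last point and [c] from that column, so it is occupied at time [m + 1]. At least [k] such
       crossings fill the row at time [m + 2]. *)
    intros i'. apply (Titer_le Z A (S (S m))); [lia |].
    apply (row_full_T k Z (Titer Z A (S m)) 0 j Hk).
    apply (row_ge_intro _ 0 j xs k); [apply NoDup_nodup | auto |].
    intros a Ha. unfold xs in Ha. rewrite nodup_In in Ha. apply in_map_iff in Ha.
    destruct Ha as ([a' b] & <- & Hab). apply Hpt in Hab. simpl.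
    apply (T_intro Z _ _ r c HmZ).
    + now apply (row_ge_mono (Titer Z A m) _ (i, j) _ r).
    + now apply (col_ge_mono (Titer Z A m) _ (a', b) _ c).
  - destruct (le_lt_dec k (length ys)) as [Hy|Hy]; [|nia].
    right. exists i. split.
    { intros Hfull. apply HmA. apply (Titer_le Z A 0); [lia |]. apply Hfull. }
    intros j'. apply (Titer_le Z A (S (S m))); [lia |].
    apply (col_full_T k Z (Titer Z A (S m)) i 0 Hk).
    apply (col_ge_intro _ i 0 ys k); [apply NoDup_nodup | auto |].
    intros b Hb. unfold ys in Hb. rewrite nodup_In in Hb. apply in_map_iff in Hb.
    destruct Hb as ([a b'] & <- & Hab). apply Hpt in Hab. simpl.
    apply (T_intro Z _ _ r c HmZ).
    + now apply (row_ge_mono (Titer Z A m) _ (a, b') _ r).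
    + now apply (col_ge_mono (Titer Z A m) _ (i, j) _ c).
Qed.

Lemma full_lines k Z A :
  bounded_by k Z -> spans Z A -> forall n,
  (forall x, Titer Z A (n * (lag k + 2)) x) \/
  exists rs cs, NoDup rs /\ NoDup cs /\ n <= length rs + length cs /\
    (forall j, In j rs -> row_full (Titer Z A (n * (lag k + 2))) j) /\
    (forall i, In i cs -> col_full (Titer Z A (n * (lag k + 2))) i).
Proof.
  intros Hk Hsp. induction n as [|n IH].
  - right. exists [], []. repeat split; try constructor; contradiction.
  - set (t := n * (lag k + 2)) in *.
    replace (S n * (lag k + 2)) with ((lag k + 2) + t) by (unfold t; lia).
    destruct IH as [IH|(rs & cs & Hrs & Hcs & Hlen & Hr & Hc)].
    { left. intros x. apply (Titer_le Z A t); auto; lia. }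
    assert (Hr' : forall j, In j rs -> row_full (Titer Z A (lag k + 2 + t)) j).
    { intros j Hj i. apply (Titer_le Z A t); [lia |]. now apply Hr. }
    assert (Hc' : forall i, In i cs -> col_full (Titer Z A (lag k + 2 + t)) i).
    { intros i Hi j. apply (Titer_le Z A t); [lia |]. now apply Hc. }
    destruct (new_full_line k Z (Titer Z A t) Hk (spans_Titer Z A t Hsp))
      as [H|[(j & Hj1 & Hj2)|(i & Hi1 & Hi2)]].
    + left. intros x. specialize (H x). apply Titer_add in H.
      revert H. apply Titer_le. lia.
    + right. exists (j :: rs), cs. split; [constructor; auto |].
      split; auto. split; [simpl; lia |]. split; auto.
      intros j' [<-|Hj']; auto. intros i. apply Titer_add. apply Hj2.
    + right. exists rs, (i :: cs). split; auto. split; [constructor; auto |].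
      split; [simpl; lia |]. split; auto.
      intros i' [<-|Hi']; auto. intros j. apply Titer_add. apply Hi2.
Qed.

(** Among [2 * k] full lines there are [k] rows or [k] columns, and these fill everything in one
    more step. *)
Lemma bounded_time k Z :
  bounded_by k Z -> exists t, forall A, spans Z A -> forall x, Titer Z A t x.
Proof.
  intros Hk. exists (S (2 * k * (lag k + 2))). intros A Hsp x.
  destruct (full_lines k Z A Hk Hsp (2 * k)) as [H|(rs & cs & Hrs & Hcs & Hlen & Hr & Hc)].
  - left. apply H.
  - destruct (le_lt_dec k (length rs)).
    + now apply (full_rows_T k Z _ rs).
    + apply (full_cols_T k Z _ cs); auto; lia.
Qed.

(** * Tracing occupation back to finitely many initial points *)

(** A point occupied at time [t + 1] depends on at most [2 * k] points at time [t], or on itself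
    alone. The factor [S (2 * k)] covers both cases, also for [k = 0]. *)
Lemma Titer_witness k Z A t l :
  bounded_by k Z -> (forall x, In x l -> Titer Z A t x) ->
  exists B, (forall y, In y B -> A y) /\ length B <= length l * (S (2 * k)) ^ t /\
    forall x, In x l -> Titer Z (fun y => In y B) t x.
Proof.
  intros Hk. revert l. induction t as [|t IH]; intros l Hl.
  { exists l. repeat split; auto. simpl. lia. }
  induction l as [|x l IHl].
  { exists []. repeat split; simpl; try lia; contradiction. }
  destruct IHl as (B2 & HB2 & Hlen2 & HT2); [intros; apply Hl; now right |].
  assert (H1 : exists B1, (forall y, In y B1 -> A y) /\
    length B1 <= S (2 * k) ^ S t /\ Titer Z (fun y => In y B1) (S t) x).
  { destruct (T_elim k Z _ x Hk (Hl x (or_introl eq_refl)))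
      as [Hx|(r & c & Hr & Hc & Hz & (lr & Hlr & Hnr & Hinr) & (lc & Hlc & Hnc & Hinc))].
    - destruct (IH [x]) as (B1 & HB1 & Hlen1 & HT1).
      { intros y [<-|[]]; auto. }
      exists B1. repeat split; auto.
      + cbn [length] in Hlen1. rewrite Nat.pow_succ_r'. nia.
      + left. apply HT1. now left.
    - destruct (IH (lr ++ lc)) as (B1 & HB1 & Hlen1 & HT1).
      { intros y Hy. apply in_app_or in Hy. destruct Hy; [now apply Hinr | now apply Hinc]. }
      exists B1. repeat split; auto.
      + rewrite length_app in Hlen1. rewrite Nat.pow_succ_r'.
        assert (length lr + length lc <= S (2 * k)) by lia. nia.
      + apply (T_intro Z _ x r c Hz).
        * exists lr. repeat split; auto; [|now apply Hinr].
          apply HT1, in_or_app. now left.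
        * exists lc. repeat split; auto; [|now apply Hinc].
          apply HT1, in_or_app. now right. }
  destruct H1 as (B1 & HB1 & Hlen1 & HT1).
  exists (B1 ++ B2). split; [|split].
  - intros y Hy. apply in_app_or in Hy. destruct Hy; auto.
  - rewrite length_app. cbn [length]. lia.
  - intros y [<-|Hy].
    + revert HT1. apply Titer_mono. intros. apply in_or_app. now left.
    + specialize (HT2 y Hy). revert HT2. apply Titer_mono. intros. apply in_or_app. now right.
Qed.

(** A spanning set occupies the [k] by [k] square by the uniform time [t]. Tracing back that square
    is enough, because the square itself spans. *)
Lemma bounded_witness Z :
  finite_set Z -> exists K, forall A, spans Z A ->
  exists B, NoDup B /\ length B <= K /\ (forall y, In y B -> A y) /\
    spans Z (fun y => In y B).
Proof.
  intros Hf. destruct (finite_bounded Z Hf) as [k Hk].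
  destruct (bounded_time k Z Hk) as [t Ht].
  exists (length (grid k k) * S (2 * k) ^ t). intros A Hsp.
  destruct (Titer_witness k Z A t (grid k k) Hk) as (B & HB & Hlen & HT).
  { intros x _. now apply Ht. }
  exists (nodup pt_eq_dec B). split; [apply NoDup_nodup |]. split; [|split].
  - etransitivity; [|exact Hlen]. apply NoDup_incl_length; [apply NoDup_nodup |].
    intros y. apply nodup_In.
  - intros y Hy. apply HB. now apply nodup_In in Hy.
  - apply (spans_mono Z (fun y => In y B)); [intros y Hy; now apply nodup_In |].
    apply (spans_of_Titer Z _ t), (spans_block k Z _ Hk).
    intros i j Hi Hj. apply HT, in_grid. lia.
Qed.

(** * Invariance under relabelling of lines *)

(** A bijection matching the tails is composed with the transposition [w] of [s x] and [y], which
    fixes the images of the tail. *)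
Lemma list_bijection (xs ys : list nat) :
  NoDup xs -> NoDup ys -> length xs = length ys ->
  exists s s' : nat -> nat, (forall a, s' (s a) = a) /\ (forall a, s (s' a) = a) /\
    map s xs = ys.
Proof.
  revert ys. induction xs as [|x xs IH]; intros [|y ys] Hx Hy Hlen; try discriminate.
  { exists (fun a => a), (fun a => a). auto. }
  inversion_clear Hx. inversion_clear Hy. injection Hlen as Hlen.
  destruct (IH ys) as (s & s' & H3 & H4 & H5); auto.
  set (w := fun a => if Nat.eq_dec a (s x) then y else if Nat.eq_dec a y then s x else a).
  assert (Hw : forall a, w (w a) = a).
  { intros a. unfold w. repeat destruct (Nat.eq_dec); congruence. }
  exists (fun a => w (s a)), (fun a => s' (w a)). repeat split.
  - intros a. now rewrite Hw.
  - intros a. now rewrite H4, Hw.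
  - simpl. f_equal.
    + unfold w. destruct (Nat.eq_dec (s x) (s x)); congruence.
    + rewrite <- H5. apply map_ext_in. intros a Ha. unfold w.
      destruct (Nat.eq_dec (s a) (s x)) as [E|_].
      * apply (f_equal s') in E. rewrite !H3 in E. congruence.
      * destruct (Nat.eq_dec (s a) y) as [E|_]; auto.
        exfalso. apply H1. rewrite <- H5, <- E. now apply in_map.
Qed.

(** Injectivity keeps the points on a line distinct, so no count drops under the relabelling. *)
Lemma Titer_image Z (f g : nat -> nat) (A B : pt -> Prop) t :
  FinFun.Injective f -> FinFun.Injective g ->
  (forall x y, A (x, y) -> B (f x, g y)) ->
  forall x y, Titer Z A t (x, y) -> Titer Z B t (f x, g y).
Proof.
  intros Hf Hg HAB. set (h := fun q : pt => (f (fst q), g (snd q))).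
  assert (Hh : FinFun.Injective h).
  { intros [a b] [c d] H. unfold h in H. simpl in H. injection H. intros E1 E2.
    apply Hf in E2. apply Hg in E1. congruence. }
  induction t as [|t IH]; simpl; auto.
  intros x y [H|(_ & r & c & Hz & (lr & H1 & H2 & H3) & (lc & H4 & H5 & H6))]; [left; auto |].
  apply (T_intro Z _ _ r c Hz).
  - exists (map h lr). rewrite length_map. split; auto.
    split; [now apply FinFun.Injective_map_NoDup |].
    intros q Hq. apply in_map_iff in Hq. destruct Hq as ([a b] & <- & Hab).
    destruct (H3 _ Hab) as [H7 H8]. simpl in *. split; [now apply IH | congruence].
  - exists (map h lc). rewrite length_map. split; auto.
    split; [now apply FinFun.Injective_map_NoDup |].
    intros q Hq. apply in_map_iff in Hq. destruct Hq as ([a b] & <- & Hab).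
    destruct (H6 _ Hab) as [H7 H8]. simpl in *. split; [now apply IH | congruence].
Qed.

(* A finite injection of coordinates extends to a permutation of all lines, and
   permutations of rows and of columns commute with the dynamics. *)
Lemma spans_embed Z (f g : nat -> nat) xs ys (A B : pt -> Prop) :
  NoDup xs -> NoDup ys -> NoDup (map f xs) -> NoDup (map g ys) ->
  (forall x y, A (x, y) -> In x xs /\ In y ys /\ B (f x, g y)) ->
  spans Z A -> spans Z B.
Proof.
  intros Hxs Hys Hf Hg HAB Hsp.
  destruct (list_bijection xs (map f xs)) as (s & s' & Hs1 & Hs2 & Hs); auto.
  { now rewrite length_map. }
  destruct (list_bijection ys (map g ys)) as (u & u' & Hu1 & Hu2 & Hu); auto.
  { now rewrite length_map. }
  assert (Hext : forall (a b : nat -> nat) l, map a l = map b l -> forall z, In z l -> a z = b z).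
  { intros a b l. induction l as [|z l IH]; simpl; [contradiction |].
    intros E z' [<-|Hz]; injection E; auto. }
  (* Surjectivity of the extended relabellings matters here: every target has a preimage, and that
     preimage becomes occupied from [A]. *)
  intros [x y]. destruct (Hsp (s' x, u' y)) as [t Ht]. exists t.
  rewrite <- (Hs2 x), <- (Hu2 y). revert Ht. apply Titer_image.
  - intros a b E. now rewrite <- (Hs1 a), <- (Hs1 b), E.
  - intros a b E. now rewrite <- (Hu1 a), <- (Hu1 b), E.
  - intros a b Hab. destruct (HAB a b Hab) as (Ha & Hb & H).
    now rewrite (Hext _ _ _ Hs a Ha), (Hext _ _ _ Hu b Hb).
Qed.

Open Scope R_scope.

(** * The energy-entropy functional *)

Definition card (l : list nat) : nat := length (nodup Nat.eq_dec l).

(** With [N] about [p^(-a)] and [M] about [p^(-b)], the expected number of copies of [B] in the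
    rectangle is about [p^val]. Positive [val] means that copies are rare. *)
Definition val (a b : R) (B : list pt) : R :=
  INR (length B) - a * INR (card (map fst B)) - b * INR (card (map snd B)).

Lemma rho_val a b A : rho a b A = fold_right Rmax 0 (map (val a b) (sublists A)).
Proof. reflexivity. Qed.

Lemma card_le_length l : (card l <= length l)%nat.
Proof. apply NoDup_incl_length; [apply NoDup_nodup | intros x; apply nodup_In]. Qed.

Lemma card_map_le_length (f : nat * nat -> nat) (B : list pt) : (card (map f B) <= length B)%nat.
Proof. eapply Nat.le_trans; [apply card_le_length | now rewrite length_map]. Qed.

Lemma card_incl l l' : incl l l' -> (card l <= card l')%nat.
Proof.
  intros H. apply NoDup_incl_length; [apply NoDup_nodup |].
  intros x. rewrite !nodup_In. apply H.
Qed.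

Lemma card_map_le (f : nat -> nat) l : (card (map f l) <= card l)%nat.
Proof.
  unfold card. rewrite <- (length_map f (nodup Nat.eq_dec l)).
  apply NoDup_incl_length; [apply NoDup_nodup |].
  intros x. rewrite nodup_In, !in_map_iff. intros (y & <- & Hy).
  exists y. split; auto. now apply nodup_In.
Qed.

Lemma card_pos l : l <> [] -> (1 <= card l)%nat.
Proof.
  destruct l as [|x l]; [congruence | intros _].
  apply (card_incl [x]). intros y [<-|[]]. now left.
Qed.

Lemma sublists_nil {X : Type} (l : list X) : In [] (sublists l).
Proof. induction l; simpl; auto. apply in_or_app. now left. Qed.

Lemma sublists_self {X : Type} (l : list X) : In l (sublists l).
Proof.
  induction l; simpl; auto. apply in_or_app. right. now apply in_map.
Qed.

Lemma sublists_filter {X : Type} f (l : list X) : In (filter f l) (sublists l).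
Proof.
  induction l as [|x l IH]; simpl; auto. apply in_or_app.
  destruct (f x); [right; now apply in_map | now left].
Qed.

Lemma sublists_incl {X : Type} (l s : list X) : In s (sublists l) -> incl s l.
Proof.
  revert s. induction l as [|x l IH]; simpl; intros s H.
  - destruct H as [<-|[]]. apply incl_refl.
  - apply in_app_or in H. destruct H as [H|H].
    + apply incl_tl. auto.
    + apply in_map_iff in H. destruct H as (s' & <- & H).
      apply incl_cons; [now left | apply incl_tl; auto].
Qed.

Lemma sublists_NoDup {X : Type} (l s : list X) : NoDup l -> In s (sublists l) -> NoDup s.
Proof.
  revert s. induction l as [|x l IH]; simpl; intros s Hn H.
  - destruct H as [<-|[]]. constructor.
  - inversion_clear Hn. apply in_app_or in H. destruct H as [H|H]; auto.
    apply in_map_iff in H. destruct H as (s' & <- & H). constructor; auto.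
    intros H'. apply sublists_incl in H. auto.
Qed.

Lemma sublists_length {X : Type} (l s : list X) :
  In s (sublists l) -> (length s <= length l)%nat.
Proof.
  revert s. induction l as [|x l IH]; simpl; intros s H.
  - destruct H as [<-|[]]. auto.
  - apply in_app_or in H. destruct H as [H|H].
    + apply IH in H. lia.
    + apply in_map_iff in H. destruct H as (s' & <- & H). apply IH in H. simpl. lia.
Qed.

(** Removing one point loses at most one value of the projection. *)
Lemma sublists_card_map (f : nat * nat -> nat) (l s : list pt) :
  In s (sublists l) -> (card (map f l) + length s <= card (map f s) + length l)%nat.
Proof.
  revert s. unfold card. induction l as [|x l IH]; cbn [sublists]; intros s H.
  - destruct H as [<-|[]]. auto.
  - apply in_app_or in H. destruct H as [H|H].
    + apply IH in H. cbn [map nodup]. destruct (in_dec Nat.eq_dec (f x) (map f l)); simpl; lia.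
    + apply in_map_iff in H. destruct H as (s' & <- & H).
      assert (Hi := sublists_incl _ _ H). apply IH in H. cbn [map nodup].
      destruct (in_dec Nat.eq_dec (f x) (map f l)) as [|n];
      destruct (in_dec Nat.eq_dec (f x) (map f s')) as [i0|]; simpl; try lia.
      exfalso. apply n. apply (incl_map f) in Hi. auto.
Qed.

Lemma val_nil a b : val a b [] = 0.
Proof. unfold val, card. simpl. lra. Qed.

Lemma rho_ge_sub a b A B : In B (sublists A) -> val a b B <= rho a b A.
Proof.
  rewrite rho_val. induction (sublists A) as [|C l IH]; simpl; [contradiction |].
  intros [->|H]; [apply Rmax_l |].
  eapply Rle_trans; [apply IH, H | apply Rmax_r].
Qed.

Lemma rho_attained a b A : exists B, In B (sublists A) /\ rho a b A = val a b B.
Proof.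
  rewrite rho_val.
  assert (H : forall l, fold_right Rmax 0 (map (val a b) l) = 0 \/
     exists B, In B l /\ fold_right Rmax 0 (map (val a b) l) = val a b B).
  { induction l as [|C l IH]; simpl; [now left |].
    apply Rmax_case.
    - right. exists C. auto.
    - destruct IH as [IH|(B & HB & IH)]; [now left | right; exists B; auto]. }
  destruct (H (sublists A)) as [E|]; auto.
  (* The starting value 0 of the fold is the value of the empty sublist, so it is attained as
     well. *)
  exists []. split; [apply sublists_nil | now rewrite val_nil].
Qed.

Lemma val_same_set a b B B' :
  NoDup B -> NoDup B' -> (forall x, In x B <-> In x B') -> val a b B = val a b B'.
Proof.
  intros Hn Hn' H. unfold val. rewrite (Permutation_length (NoDup_Permutation Hn Hn' H)).
  f_equal; [f_equal |]; do 2 f_equal;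
  apply Nat.le_antisymm; apply card_incl, incl_map; intros x; apply H.
Qed.

Lemma rho_ge a b A B : NoDup A -> NoDup B -> incl B A -> val a b B <= rho a b A.
Proof.
  intros HA HB Hi.
  rewrite (val_same_set a b B (filter (fun x => if in_dec pt_eq_dec x B then true else false) A)).
  - apply rho_ge_sub, sublists_filter.
  - auto.
  - now apply NoDup_filter.
  - intros x. rewrite filter_In. destruct in_dec; intuition (auto; discriminate).
Qed.

(** Only points must stay distinct. If [f] or [g] merges lines, the projection counts drop, and
    since [a] and [b] are nonnegative this can only raise [val]. *)
Lemma rho_embed a b (f g : nat -> nat) A A' :
  0 <= a -> 0 <= b -> NoDup A -> NoDup A' ->
  (forall q q', In q A' -> In q' A' ->
     (f (fst q), g (snd q)) = (f (fst q'), g (snd q')) -> q = q') ->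
  (forall q, In q A' -> In (f (fst q), g (snd q)) A) ->
  rho a b A' <= rho a b A.
Proof.
  intros Ha Hb HA HA' Hinj Hin. set (h := fun q : pt => (f (fst q), g (snd q))).
  destruct (rho_attained a b A') as (B & HB & ->).
  assert (Hi := sublists_incl _ _ HB). assert (Hn := sublists_NoDup _ _ HA' HB).
  apply Rle_trans with (val a b (map h B)).
  - assert (E1 : map fst (map h B) = map f (map fst B)) by now rewrite !map_map.
    assert (E2 : map snd (map h B) = map g (map snd B)) by now rewrite !map_map.
    unfold val. rewrite length_map, E1, E2.
    assert (H1 := card_map_le f (map fst B)). assert (H2 := card_map_le g (map snd B)).
    apply le_INR in H1, H2.
    apply (Rmult_le_compat_l a _ _ Ha) in H1. apply (Rmult_le_compat_l b _ _ Hb) in H2. lra.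
  - apply rho_ge; auto.
    + apply FinFun.Injective_map_NoDup_in; auto.
    + intros x Hx. apply in_map_iff in Hx. destruct Hx as (q & <- & Hq). apply Hin; auto.
Qed.

Lemma rho_antitone a b a' b' A : a <= a' -> b <= b' -> rho a' b' A <= rho a b A.
Proof.
  intros Ha Hb. destruct (rho_attained a' b' A) as (B & HB & ->).
  apply Rle_trans with (val a b B); [|now apply rho_ge_sub].
  unfold val. assert (H1 := pos_INR (card (map fst B))).
  assert (H2 := pos_INR (card (map snd B))). nra.
Qed.

Lemma rho_lipschitz a b a' b' A :
  rho a b A <= rho a' b' A + INR (length A) * (Rabs (a' - a) + Rabs (b' - b)).
Proof.
  destruct (rho_attained a b A) as (B & HB & ->).
  assert (H := rho_ge_sub a' b' A B HB). assert (Hl := sublists_length _ _ HB).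
  unfold val in *. assert (H1 := pos_INR (card (map fst B))).
  assert (H2 := pos_INR (card (map snd B))).
  assert (H3 := card_map_le_length fst B). assert (H4 := card_map_le_length snd B).
  assert (H5 : (card (map fst B) <= length A)%nat) by lia.
  assert (H6 : (card (map snd B) <= length A)%nat) by lia.
  apply le_INR in H5, H6.
  assert (H7 := Rle_abs (a' - a)). assert (H8 := Rle_abs (b' - b)).
  assert (H9 := Rabs_pos (a' - a)). assert (H10 := Rabs_pos (b' - b)). nra.
Qed.

(** A further point adds 1 and costs at most [a + b], for one new column and one new row, so the
    whole set is a maximiser. On the triangle [rho] is therefore affine, which makes the minimum
    concave there. *)
Lemma rho_triangle a b A : quadrant a b -> a + b <= 1 -> rho a b A = val a b A.
Proof.
  intros [Ha Hb] Hab. apply Rle_antisym; [|apply rho_ge_sub, sublists_self].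
  destruct (rho_attained a b A) as (B & HB & ->).
  assert (H1 := sublists_card_map fst _ _ HB). assert (H2 := sublists_card_map snd _ _ HB).
  assert (H3 := sublists_length _ _ HB). unfold val.
  apply le_INR in H1, H2, H3. rewrite !plus_INR in H1, H2. nra.
Qed.

Lemma rho_zero A : rho 0 0 A = INR (length A).
Proof. rewrite rho_triangle; [unfold val; lra | split; lra | lra]. Qed.

(** A nonempty maximiser pays for at least one column and one row, one of which has a positive
    price. An empty one has value 0. *)
Lemma rho_lt_length a b A :
  quadrant a b -> (a, b) <> (0, 0) -> A <> [] -> rho a b A < INR (length A).
Proof.
  intros [Ha Hb] Hab HA. destruct (rho_attained a b A) as (B & HB & ->).
  assert (Hl := sublists_length _ _ HB). apply le_INR in Hl.
  destruct B as [|q B].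
  - rewrite val_nil. apply lt_0_INR. destruct A; [congruence | simpl; lia].
  - unfold val. assert (H1 := card_pos (map fst (q :: B))).
    assert (H2 := card_pos (map snd (q :: B))).
    assert (H1' : 1 <= INR (card (map fst (q :: B)))).
    { apply (le_INR 1), H1. discriminate. }
    assert (H2' : 1 <= INR (card (map snd (q :: B)))).
    { apply (le_INR 1), H2. discriminate. }
    assert (0 < a \/ 0 < b) as [H|H].
    { destruct (Rle_lt_or_eq_dec _ _ Ha) as [|E]; auto.
      destruct (Rle_lt_or_eq_dec _ _ Hb) as [|E']; auto. congruence. }
    + nra.
    + nra.
Qed.

(** * Spanning sets of bounded size *)

(** The family $\mathcal A_0$ of the theorem; the [K] chosen later depends on [Z] only. *)
Definition small_spanning (Z : pt -> Prop) (K : nat) : list (list pt) :=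
  filter (fun A => if excluded_middle_informative (spans Z (fun x => In x A))
                   then true else false) (sublists (grid K K)).

Lemma NoDup_grid N M : NoDup (grid N M).
Proof.
  unfold grid. generalize (seq_NoDup N 0). generalize (seq 0 N).
  intros l. induction l as [|x l IH]; simpl; [constructor |].
  intros H. inversion_clear H. apply NoDup_app; auto.
  - apply FinFun.Injective_map_NoDup, seq_NoDup. intros y z E. congruence.
  - intros [a b] H2 H3. apply in_map_iff in H2. destruct H2 as (y & E & _).
    apply in_prod_iff in H3. injection E as <- <-. tauto.
Qed.

Lemma small_spanning_iff Z K A :
  In A (small_spanning Z K) <-> In A (sublists (grid K K)) /\ spans Z (fun x => In x A).
Proof.
  unfold small_spanning. rewrite filter_In.
  destruct excluded_middle_informative; intuition discriminate.
Qed.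

Lemma small_spanning_fin Z K A : In A (small_spanning Z K) -> fin_spanning Z A.
Proof.
  rewrite small_spanning_iff. intros [H1 H2]. split; auto.
  apply (sublists_NoDup (grid K K)); auto using NoDup_grid.
Qed.

Lemma small_spanning_length Z K A : In A (small_spanning Z K) -> (length A <= K * K)%nat.
Proof.
  rewrite small_spanning_iff. intros [H1 _]. rewrite <- length_grid. now apply sublists_length.
Qed.

Fixpoint index (l : list nat) (a : nat) : nat :=
  match l with
  | [] => 0
  | x :: l' => if Nat.eq_dec a x then 0 else S (index l' a)
  end.

Lemma index_lt l a : In a l -> (index l a < length l)%nat.
Proof.
  induction l as [|x l IH]; simpl; [contradiction |].
  destruct (Nat.eq_dec a x); [lia |]. intros [->|H]; [congruence | apply IH in H; lia].
Qed.

Lemma nth_index l a d : In a l -> nth (index l a) l d = a.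
Proof.
  induction l as [|x l IH]; simpl; [contradiction |].
  destruct (Nat.eq_dec a x); auto. intros [->|H]; [congruence | auto].
Qed.

Lemma NoDup_map_index l : NoDup l -> NoDup (map (index l) l).
Proof.
  apply FinFun.Injective_map_NoDup_in. intros x y Hx Hy E.
  rewrite <- (nth_index l x 0 Hx), <- (nth_index l y 0 Hy). now rewrite E.
Qed.

(** The only requirement on [K]. The set [A] need not be finite, and the property serves both for
    finite spanning sets and for outcomes of the random set. *)
Definition small_copies (Z : pt -> Prop) (K : nat) : Prop :=
  forall A, spans Z A -> exists A' (f g : nat -> nat), In A' (small_spanning Z K) /\
    (forall q q', In q A' -> In q' A' ->
       (f (fst q), g (snd q)) = (f (fst q'), g (snd q')) -> q = q') /\
    (forall q : pt, In q A' -> A (f (fst q), g (snd q))).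

(** A witness [B] with at most [K] points meets at most [K] columns and [K] rows. Replacing each
    coordinate by its position among those used moves [B] into the grid, and [f] and [g] read the
    positions back. *)
Lemma small_copies_exist Z : finite_set Z -> exists K, small_copies Z K.
Proof.
  intros Hf. destruct (bounded_witness Z Hf) as [K HK]. exists K. intros A HA.
  destruct (HK A HA) as (B & HBn & HBK & HBA & HBs).
  set (cx := nodup Nat.eq_dec (map fst B)). set (cy := nodup Nat.eq_dec (map snd B)).
  assert (Hcx : NoDup cx) by apply NoDup_nodup.
  assert (Hcy : NoDup cy) by apply NoDup_nodup.
  assert (HlX : (length cx <= K)%nat).
  { assert (H := card_map_le_length fst B). unfold card in H.
    fold cx in H. lia. }
  assert (HlY : (length cy <= K)%nat).
  { assert (H := card_map_le_length snd B). unfold card in H.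
    fold cy in H. lia. }
  assert (HBc : forall x y, In (x, y) B -> In x cx /\ In y cy).
  { intros x y H. unfold cx, cy. rewrite !nodup_In.
    split; [now apply (in_map fst) in H | now apply (in_map snd) in H]. }
  clearbody cx cy.
  set (h := fun q : pt => (nth (fst q) cx 0%nat, nth (snd q) cy 0%nat)).
  set (A' := filter (fun q => ((fst q <? length cx) && (snd q <? length cy) &&
     if in_dec pt_eq_dec (h q) B then true else false)%nat%bool) (grid K K)).
  assert (HA' : forall q, In q A' -> (fst q < length cx)%nat /\ (snd q < length cy)%nat /\ In (h q) B).
  { intros q Hq. apply filter_In in Hq. destruct Hq as [_ Hq].
    rewrite !Bool.andb_true_iff, !Nat.ltb_lt in Hq.
    destruct (in_dec pt_eq_dec (h q) B); intuition discriminate. }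
  exists A', (fun i => nth i cx 0%nat), (fun i => nth i cy 0%nat).
  split; [|split].
  - apply small_spanning_iff. split; [apply sublists_filter |].
    apply (spans_embed Z (index cx) (index cy) cx cy (fun x => In x B));
      auto using NoDup_map_index.
    intros x y Hxy. destruct (HBc x y Hxy) as [Hx Hy]. repeat split; auto.
    assert (Hx' := index_lt _ _ Hx). assert (Hy' := index_lt _ _ Hy).
    apply filter_In. split; [apply in_grid; lia |].
    rewrite !Bool.andb_true_iff, !Nat.ltb_lt. repeat split; auto.
    unfold h. cbn [fst snd]. rewrite !nth_index by auto.
    destruct in_dec; auto.
  - intros [a b] [c d] Hq Hq' E. cbn [fst snd] in E. injection E as E1 E2.
    apply HA' in Hq, Hq'. simpl in Hq, Hq'.
    f_equal; [apply (proj1 (NoDup_nth cx 0%nat) Hcx) | apply (proj1 (NoDup_nth cy 0%nat) Hcy)]; tauto.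
  - intros q Hq. apply HA' in Hq. apply HBA. apply Hq.
Qed.

(** * The rate as a minimum over a finite family *)

(** No real number is neutral for [Rmin], so the fold starts from the value at the head, itself a
    member of a nonempty family. *)
Definition rate (A0 : list (list pt)) (a b : R) : R :=
  fold_right Rmin (rho a b (hd [] A0)) (map (rho a b) A0).

Lemma rate_le A0 a b A : In A A0 -> rate A0 a b <= rho a b A.
Proof.
  unfold rate. generalize (rho a b (hd [] A0)). intros r.
  induction A0 as [|C l IH]; simpl; [contradiction |].
  intros [->|H]; [apply Rmin_l |]. eapply Rle_trans; [apply Rmin_r | auto].
Qed.

Lemma rate_attained A0 a b : A0 <> [] -> exists A, In A A0 /\ rate A0 a b = rho a b A.
Proof.
  intros Hne. assert (Hhd : In (hd [] A0) A0) by (destruct A0; [congruence | now left]).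
  unfold rate. revert Hhd. generalize (hd [] A0). intros A1.
  assert (H : forall l, incl l A0 -> In A1 A0 -> exists A, In A A0 /\
    fold_right Rmin (rho a b A1) (map (rho a b) l) = rho a b A).
  { induction l as [|C l IH]; simpl; intros Hi HA1; [now exists A1 |].
    apply Rmin_case.
    - exists C. split; auto. apply Hi. now left.
    - apply IH; auto. eapply incl_cons_inv; eauto. }
  apply H, incl_refl.
Qed.

Lemma rate_le_spanning Z K a b A :
  small_copies Z K -> quadrant a b -> fin_spanning Z A ->
  rate (small_spanning Z K) a b <= rho a b A.
Proof.
  intros HK [Ha Hb] [HA Hs]. destruct (HK _ Hs) as (A' & f & g & HA' & Hinj & Hin).
  eapply Rle_trans; [apply (rate_le _ a b A' HA') |].
  apply (rho_embed a b f g); auto. apply (small_spanning_fin _ _ _ HA').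
Qed.

Lemma small_spanning_nonempty Z K : finite_set Z -> small_copies Z K -> small_spanning Z K <> [].
Proof.
  intros Hf HK. destruct (finite_bounded Z Hf) as [k Hk].
  destruct (HK (fun x => In x (grid k k))) as (A' & _ & _ & HA' & _).
  - apply (spans_block k Z _ Hk). intros i j Hi Hj. now apply in_grid.
  - intros E. now rewrite E in HA'.
Qed.

Lemma rate_continuous Z K : small_spanning Z K <> [] ->
  continuous_quadrant (rate (small_spanning Z K)).
Proof.
  intros Hne.
  assert (H : forall a b a' b', rate (small_spanning Z K) a b <=
    rate (small_spanning Z K) a' b' + INR (K * K) * (Rabs (a' - a) + Rabs (b' - b))).
  { intros a b a' b'. destruct (rate_attained _ a' b' Hne) as (A & HA & ->).
    eapply Rle_trans; [apply (rate_le _ a b A HA) |].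
    eapply Rle_trans; [apply (rho_lipschitz a b a' b') |].
    apply small_spanning_length, le_INR in HA.
    assert (H9 := Rabs_pos (a' - a)). assert (H10 := Rabs_pos (b' - b)). nra. }
  intros a b _ eps Heps. assert (HK := pos_INR (K * K)).
  (* [K * K] bounds the size of every member and so is a common Lipschitz constant. The 2 counts the
     coordinates, and the 1 keeps the denominator positive. *)
  exists (eps / (2 * INR (K * K) + 1)).
  assert (Hd : 0 < eps / (2 * INR (K * K) + 1)) by (apply Rdiv_lt_0_compat; lra).
  split; auto. intros a' b' _ Ha Hb.
  assert (H1 := H a b a' b'). assert (H2 := H a' b' a b).
  rewrite (Rabs_minus_sym a a'), (Rabs_minus_sym b b') in H2.
  assert (H3 : INR (K * K) * (Rabs (a' - a) + Rabs (b' - b)) < eps).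
  { set (d := eps / (2 * INR (K * K) + 1)) in *.
    assert (E : d * (2 * INR (K * K) + 1) = eps) by (unfold d; field; lra). nra. }
  apply Rabs_def1; lra.
Qed.

Lemma rate_piecewise_linear A0 : A0 <> [] -> piecewise_linear_quadrant (rate A0).
Proof.
  intros Hne.
  exists (flat_map (fun A => map (fun B => (INR (length B), - INR (card (map fst B)),
     - INR (card (map snd B)))) (sublists A)) A0).
  intros a b _. destruct (rate_attained A0 a b Hne) as (A & HA & E).
  destruct (rho_attained a b A) as (B & HB & E').
  exists (INR (length B), - INR (card (map fst B)), - INR (card (map snd B))). split.
  - apply in_flat_map. exists A. split; auto. apply in_map_iff. now exists B.
  - rewrite E, E'. unfold val. simpl. ring.
Qed.

Lemma rate_antitone A0 a b a' b' :
  A0 <> [] -> a <= a' -> b <= b' -> rate A0 a' b' <= rate A0 a b.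
Proof.
  intros Hne Ha Hb. destruct (rate_attained A0 a b Hne) as (A & HA & ->).
  eapply Rle_trans; [apply (rate_le _ _ _ _ HA) | now apply rho_antitone].
Qed.

Lemma rate_concave A0 : A0 <> [] -> concave_on_triangle (rate A0).
Proof.
  intros Hne a1 b1 a2 b2 t Hq1 H1 Hq2 H2 Ht.
  destruct (rate_attained A0 (t * a1 + (1 - t) * a2) (t * b1 + (1 - t) * b2) Hne)
    as (A & HA & ->).
  assert (E1 := rate_le A0 a1 b1 A HA). assert (E2 := rate_le A0 a2 b2 A HA).
  rewrite rho_triangle in E1, E2 by auto.
  destruct Hq1, Hq2. rewrite rho_triangle; [|split; nra | nra].
  apply Rle_trans with (t * val a1 b1 A + (1 - t) * val a2 b2 A).
  - apply Rplus_le_compat; apply Rmult_le_compat_l; lra.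
  - apply Req_le. unfold val. ring.
Qed.

Lemma empty_not_spanning (Z : pt -> Prop) : Z (0, 0)%nat -> ~ spans Z (fun x => In x []).
Proof.
  intros HZ Hs. destruct (Hs (0, 0)%nat) as [t Ht].
  apply Titer_stationary in Ht; [contradiction |].
  intros x [[]|(_ & r & c & Hz & (l1 & H1 & _ & H2) & (l2 & H3 & _ & H4))].
  destruct l1 as [|q l1]; [|destruct (H2 q); [now left | contradiction]].
  destruct l2 as [|q l2]; [|destruct (H4 q); [now left | contradiction]].
  simpl in *. subst. contradiction.
Qed.

(** At the origin [rho] counts points, so a minimiser [A] there has the least size. The same [A]
    gives the strict bound elsewhere, being nonempty. *)
Lemma rate_zero_gamma Z K :
  Z (0, 0)%nat -> small_copies Z K -> small_spanning Z K <> [] ->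
  exists g, gamma_spec Z g /\ rate (small_spanning Z K) 0 0 = INR g /\
    forall a b, quadrant a b -> (a, b) <> (0, 0) -> rate (small_spanning Z K) a b < INR g.
Proof.
  intros HZ HK Hne. destruct (rate_attained _ 0 0 Hne) as (A & HA & E).
  assert (HAf := small_spanning_fin _ _ _ HA).
  rewrite rho_zero in E. exists (length A). split; [split |split].
  - now exists A.
  - intros A' HA'. apply INR_le. rewrite <- E, <- (rho_zero A').
    apply (rate_le_spanning Z K); auto. split; lra.
  - auto.
  - intros a b Hq Hab. eapply Rle_lt_trans; [apply (rate_le _ _ _ _ HA) |].
    apply rho_lt_length; auto. intros ->. apply (empty_not_spanning Z HZ). apply HAf.
Qed.

(** * Finite sums *)

Definition sum {X : Type} (l : list X) (f : X -> R) : R := fold_right Rplus 0 (map f l).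

Lemma sum_le {X : Type} (l : list X) f g :
  (forall x, In x l -> f x <= g x) -> sum l f <= sum l g.
Proof.
  unfold sum. induction l as [|x l IH]; simpl; intros H; [lra |].
  apply Rplus_le_compat; auto.
Qed.

Lemma sum_ext {X : Type} (l : list X) f g :
  (forall x, In x l -> f x = g x) -> sum l f = sum l g.
Proof.
  intros H. apply Rle_antisym; apply sum_le; intros x Hx; rewrite H; auto; lra.
Qed.

Lemma sum_nonneg {X : Type} (l : list X) f : (forall x, In x l -> 0 <= f x) -> 0 <= sum l f.
Proof.
  unfold sum. induction l as [|x l IH]; simpl; intros H; [lra |].
  apply Rplus_le_le_0_compat; auto.
Qed.

Lemma sum_ge_term {X : Type} (l : list X) f x :
  (forall y, In y l -> 0 <= f y) -> In x l -> f x <= sum l f.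
Proof.
  induction l as [|y l IH]; [contradiction |]. intros H Hx.
  unfold sum. simpl. fold (sum l f).
  assert (Hy := H y (or_introl eq_refl)).
  assert (Hl : 0 <= sum l f) by (apply sum_nonneg; intros; apply H; now right).
  destruct Hx as [->|Hx]; [lra |].
  assert (f x <= sum l f); [|lra]. apply IH; auto. intros. apply H. now right.
Qed.

Lemma sum_app {X : Type} (l l' : list X) f : sum (l ++ l') f = sum l f + sum l' f.
Proof. unfold sum. induction l as [|x l IH]; simpl; [ring | rewrite IH; ring]. Qed.

Lemma sum_map {X Y : Type} (h : X -> Y) (l : list X) f : sum (map h l) f = sum l (fun x => f (h x)).
Proof. unfold sum. now rewrite map_map. Qed.

Lemma sum_add {X : Type} (l : list X) f g : sum l (fun x => f x + g x) = sum l f + sum l g.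
Proof. unfold sum. induction l as [|x l IH]; simpl; [ring | rewrite IH; ring]. Qed.

Lemma sum_scal {X : Type} (l : list X) c f : sum l (fun x => c * f x) = c * sum l f.
Proof. unfold sum. induction l as [|x l IH]; simpl; [ring | rewrite IH; ring]. Qed.

Lemma sum_const {X : Type} (l : list X) c : sum l (fun _ => c) = INR (length l) * c.
Proof.
  unfold sum. induction l as [|x l IH]; [simpl; ring |].
  cbn [map fold_right length]. rewrite IH, S_INR. ring.
Qed.

Lemma sum_swap {X Y : Type} (l : list X) (l' : list Y) f :
  sum l (fun x => sum l' (fun y => f x y)) = sum l' (fun y => sum l (fun x => f x y)).
Proof.
  induction l as [|x l IH]; unfold sum at 1; simpl.
  - unfold sum at 2; simpl. rewrite sum_const. ring.
  - fold (sum l (fun x => sum l' (fun y => f x y))). rewrite IH, <- sum_add.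
    apply sum_ext. reflexivity.
Qed.

Lemma sum_prod {X Y : Type} (l : list X) (l' : list Y) f :
  sum (list_prod l l') f = sum l (fun x => sum l' (fun y => f (x, y))).
Proof.
  induction l as [|x l IH]; simpl; auto. rewrite sum_app, sum_map, IH. reflexivity.
Qed.

Lemma sum_mult {X Y : Type} (l : list X) (l' : list Y) f g :
  sum l f * sum l' g = sum l (fun x => sum l' (fun y => f x * g y)).
Proof.
  rewrite Rmult_comm, <- sum_scal. apply sum_ext. intros x _.
  rewrite sum_scal. ring.
Qed.

(** * The Bernoulli random set *)

Lemma indic_true P : P -> indic P = 1.
Proof. intros. unfold indic. destruct excluded_middle_informative; [auto | contradiction]. Qed.

Lemma indic_false P : ~ P -> indic P = 0.
Proof. intros. unfold indic. destruct excluded_middle_informative; [contradiction | auto]. Qed.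

Lemma indic_le (P Q : Prop) : (P -> Q) -> indic P <= indic Q.
Proof.
  intros H. destruct (classic P) as [HP|HP].
  - rewrite !indic_true by auto. lra.
  - rewrite (indic_false P HP). unfold indic. destruct excluded_middle_informative; lra.
Qed.

Lemma indic_iff (P Q : Prop) : (P <-> Q) -> indic P = indic Q.
Proof. intros H. apply Rle_antisym; apply indic_le; tauto. Qed.

Lemma indic_bounds P : 0 <= indic P <= 1.
Proof. unfold indic. destruct excluded_middle_informative; lra. Qed.

Lemma indic_and P Q : indic P * indic Q = indic (P /\ Q).
Proof.
  destruct (classic P); [|rewrite (indic_false P), (indic_false (P /\ Q)) by tauto; ring].
  rewrite (indic_true P) by auto. rewrite Rmult_1_l. apply indic_iff. tauto.
Qed.

Definition expect (p : R) (G : list pt) (f : list pt -> R) : R :=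
  sum (sublists G) (fun S => p ^ length S * (1 - p) ^ (length G - length S) * f S).

Lemma Pspan_expect Z N M p :
  Pspan Z N M p = expect p (grid N M) (fun S => indic (spans Z (fun x => In x S))).
Proof. unfold expect. now rewrite length_grid. Qed.

Lemma expect_cons p x G f :
  expect p (x :: G) f = (1 - p) * expect p G f + p * expect p G (fun S => f (x :: S)).
Proof.
  unfold expect. cbn [sublists]. rewrite sum_app, sum_map, <- !sum_scal. f_equal.
  - apply sum_ext. intros S HS. apply sublists_length in HS. cbn [length].
    rewrite Nat.sub_succ_l by auto. simpl. ring.
  - apply sum_ext. intros S HS. cbn [length]. rewrite Nat.sub_succ. simpl. ring.
Qed.

Lemma expect_le p G f g :
  0 <= p <= 1 -> (forall S, In S (sublists G) -> f S <= g S) -> expect p G f <= expect p G g.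
Proof.
  intros Hp H. apply sum_le. intros S HS. apply Rmult_le_compat_l; auto.
  apply Rmult_le_pos; apply pow_le; lra.
Qed.

Lemma expect_ext p G f g :
  (forall S, In S (sublists G) -> f S = g S) -> expect p G f = expect p G g.
Proof. intros H. apply sum_ext. intros S HS. now rewrite H. Qed.

Lemma expect_plus p G f g : expect p G (fun S => f S + g S) = expect p G f + expect p G g.
Proof. unfold expect. rewrite <- sum_add. apply sum_ext. intros. ring. Qed.

Lemma expect_scal p G c f : expect p G (fun S => c * f S) = c * expect p G f.
Proof. unfold expect. rewrite <- sum_scal. apply sum_ext. intros. ring. Qed.

Lemma expect_sum {X : Type} p G (l : list X) f :
  expect p G (fun S => sum l (fun x => f x S)) = sum l (fun x => expect p G (f x)).
Proof.
  unfold expect. rewrite sum_swap. apply sum_ext. intros S _. now rewrite <- sum_scal.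
Qed.

Lemma expect_one p G : expect p G (fun _ => 1) = 1.
Proof.
  induction G as [|x G IH]; [unfold expect, sum; simpl; ring |].
  rewrite expect_cons, IH. ring.
Qed.

Lemma expect_contains p G C :
  NoDup G -> NoDup C -> incl C G -> expect p G (fun S => indic (incl C S)) = p ^ length C.
Proof.
  revert C. induction G as [|x G IH]; intros C HG HC Hi.
  - apply incl_l_nil in Hi. subst. unfold expect, sum. simpl.
    rewrite indic_true by apply incl_refl. ring.
  - inversion_clear HG as [|? ? Hx HG']. rewrite expect_cons.
    destruct (in_dec pt_eq_dec x C) as [Hin|Hin].
    + apply in_split in Hin. destruct Hin as (C1 & C2 & ->).
      assert (HC' := NoDup_remove_1 _ _ _ HC). assert (HxC := NoDup_remove_2 _ _ _ HC).
      rewrite (expect_ext p G _ (fun _ => 0 * 1)), expect_scal.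
      2:{ intros S HS. rewrite indic_false; [ring |]. intros H.
          apply Hx, (sublists_incl _ _ HS), H, in_elt. }
      rewrite (expect_ext p G (fun S => indic (incl _ (x :: S))) (fun S => indic (incl (C1 ++ C2) S))).
      2:{ intros S HS. apply indic_iff. split.
          - intros H y Hy. destruct (H y) as [<-|]; auto; [|contradiction].
            apply in_app_iff in Hy. apply in_app_iff. simpl. tauto.
          - intros H y Hy. apply in_app_iff in Hy. simpl in Hy.
            destruct Hy as [Hy|[->|Hy]]; [right | now left | right]; apply H, in_app_iff; auto. }
      rewrite IH; auto.
      * rewrite !length_app. simpl. rewrite Nat.add_succ_r. simpl. ring.
      * intros y Hy. destruct (Hi y) as [<-|]; auto; [|contradiction].
        apply in_app_iff in Hy. apply in_app_iff. simpl. tauto.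
    + rewrite (expect_ext p G (fun S => indic (incl C (x :: S))) (fun S => indic (incl C S))).
      2:{ intros S HS. apply indic_iff. split.
          - intros H y Hy. destruct (H y Hy) as [<-|]; auto. contradiction.
          - intros H y Hy. right. auto. }
      rewrite IH; auto; [ring |].
      intros y Hy. destruct (Hi y Hy) as [<-|]; auto. contradiction.
Qed.

(** [NoDup C] belongs to the event because a list with repetitions has fewer points than its length,
    and the bound could fail. Relabellings that merge points thus contribute nothing. *)
Lemma expect_contains_le p G C :
  0 <= p -> NoDup G ->
  expect p G (fun S => indic (NoDup C /\ incl C S)) <= p ^ length C.
Proof.
  intros Hp HG. destruct (classic (NoDup C /\ incl C G)) as [[H1 H2]|H].
  - rewrite <- (expect_contains p G C) by auto. apply Req_le, expect_ext.
    intros S _. apply indic_iff. tauto.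
  - rewrite (expect_ext p G _ (fun _ => 0 * 1)), expect_scal, Rmult_0_l; [now apply pow_le |].
    intros S HS. rewrite indic_false; [ring |]. intros [H1 H2]. apply H. split; auto.
    apply (incl_tran H2), (sublists_incl _ _ HS).
Qed.

Lemma Pspan_le_1 Z N M p : 0 <= p <= 1 -> Pspan Z N M p <= 1.
Proof.
  intros Hp. rewrite Pspan_expect, <- (expect_one p (grid N M)).
  apply expect_le; auto. intros. apply indic_bounds.
Qed.

Fixpoint tuples {X : Type} (vals : list X) (k : nat) : list (list X) :=
  match k with
  | O => [[]]
  | S k' => map (fun w => fst w :: snd w) (list_prod vals (tuples vals k'))
  end.

Lemma in_tuples {X : Type} (vals : list X) k t :
  In t (tuples vals k) <-> length t = k /\ incl t vals.
Proof.
  revert t. induction k as [|k IH]; intros t; cbn [tuples].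
  - split.
    + intros [<-|[]]. split; auto. apply incl_nil_l.
    + intros [H _]. destruct t; [now left | discriminate].
  - rewrite in_map_iff. split.
    + intros ([v s] & <- & H). apply in_prod_iff in H. rewrite IH in H. simpl.
      destruct H as (H1 & H2 & H3). split; [now f_equal | now apply incl_cons].
    + intros [H1 H2]. destruct t as [|v s]; [discriminate |].
      exists (v, s). split; auto. apply in_prod_iff. apply incl_cons_inv in H2.
      rewrite IH. injection H1. tauto.
Qed.

Lemma length_tuples {X : Type} (vals : list X) k :
  INR (length (tuples vals k)) = INR (length vals) ^ k.
Proof.
  induction k as [|k IH]; auto. cbn [tuples]. rewrite length_map, length_prod, mult_INR, IH.
  reflexivity.
Qed.

Lemma sum_tuples_succ {X : Type} (vals : list X) k f :
  sum (tuples vals (S k)) f = sum vals (fun v => sum (tuples vals k) (fun t => f (v :: t))).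
Proof. cbn [tuples]. rewrite sum_map, sum_prod. reflexivity. Qed.

(** * First moment bound *)

Definition assign (l t : list nat) (x : nat) : nat := nth (index l x) t 0%nat.

Lemma assign_map f l x : In x l -> assign l (map f l) x = f x.
Proof.
  intros H. unfold assign. rewrite (nth_indep _ 0%nat (f 0%nat)).
  - now rewrite map_nth, nth_index.
  - rewrite length_map. now apply index_lt.
Qed.

Definition relabel (B : list pt) (t u : list nat) : list pt :=
  map (fun q => (assign (nodup Nat.eq_dec (map fst B)) t (fst q),
                 assign (nodup Nat.eq_dec (map snd B)) u (snd q))) B.

(** A spanning outcome contains a copy of some [A], hence of [sel A]. The free choice of [sel] lets
    the costliest subpattern be counted instead of [A]. *)
Lemma Pspan_le_copies Z K N M p (sel : list pt -> list pt) :
  small_copies Z K -> 0 <= p <= 1 -> (forall A, In (sel A) (sublists A)) ->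
  Pspan Z N M p <= sum (small_spanning Z K) (fun A =>
    INR N ^ card (map fst (sel A)) * INR M ^ card (map snd (sel A)) * p ^ length (sel A)).
Proof.
  intros HK Hp Hsel. rewrite Pspan_expect.
  set (ts := fun A => list_prod (tuples (seq 0 N) (card (map fst (sel A))))
                               (tuples (seq 0 M) (card (map snd (sel A))))).
  apply Rle_trans with (expect p (grid N M) (fun S =>
    sum (small_spanning Z K) (fun A => sum (ts A) (fun w =>
      indic (NoDup (relabel (sel A) (fst w) (snd w)) /\
             incl (relabel (sel A) (fst w) (snd w)) S))))).
  - apply expect_le; auto. intros S HS.
    assert (Hpos : forall A w, 0 <= indic (NoDup (relabel (sel A) (fst w) (snd w)) /\
             incl (relabel (sel A) (fst w) (snd w)) S)) by (intros; apply indic_bounds).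
    destruct (classic (spans Z (fun x => In x S))) as [Hs|Hs].
    2:{ rewrite indic_false by auto. apply sum_nonneg. intros A _. now apply sum_nonneg. }
    rewrite indic_true by auto.
    destruct (HK _ Hs) as (A & f & g & HA & Hinj & Hin).
    eapply Rle_trans; [|apply (sum_ge_term _ _ A); auto; intros; now apply sum_nonneg].
    set (B := sel A). assert (HB : In B (sublists A)) by apply Hsel.
    assert (HBA := sublists_incl _ _ HB).
    set (cx := nodup Nat.eq_dec (map fst B)). set (cy := nodup Nat.eq_dec (map snd B)).
    assert (Hcx : forall q, In q B -> In (fst q) cx)
      by (intros q Hq; apply nodup_In, in_map, Hq).
    assert (Hcy : forall q, In q B -> In (snd q) cy)
      by (intros q Hq; apply nodup_In, in_map, Hq).
    assert (HSg : forall q, In q B -> (f (fst q) < N /\ g (snd q) < M)%nat).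
    { intros q Hq. apply in_grid, (sublists_incl _ _ HS), Hin, HBA, Hq. }
    (* The copy present in [S] is the relabelling whose tuples list the images of the used columns
       and rows. *)
    assert (HR : relabel B (map f cx) (map g cy) = map (fun q => (f (fst q), g (snd q))) B).
    { unfold relabel. apply map_ext_in. intros q Hq. now rewrite !assign_map by auto. }
    eapply Rle_trans; [|apply (sum_ge_term _ _ (map f cx, map g cy)); auto].
    + apply Req_le. symmetry. apply indic_true. simpl. fold B. rewrite HR. split.
      * apply FinFun.Injective_map_NoDup_in; auto.
        apply (sublists_NoDup A); auto. apply (small_spanning_fin Z K A HA).
      * intros x Hx. apply in_map_iff in Hx. destruct Hx as (q & <- & Hq). auto.
    + unfold ts. apply in_prod_iff. fold B. rewrite !in_tuples, !length_map. repeat split; auto.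
      * intros x Hx. apply in_map_iff in Hx. destruct Hx as (c & <- & Hc).
        apply nodup_In, in_map_iff in Hc. destruct Hc as (q & <- & Hq).
        apply in_seq. specialize (HSg q Hq). lia.
      * intros x Hx. apply in_map_iff in Hx. destruct Hx as (c & <- & Hc).
        apply nodup_In, in_map_iff in Hc. destruct Hc as (q & <- & Hq).
        apply in_seq. specialize (HSg q Hq). lia.
  - rewrite expect_sum. apply sum_le. intros A HA. rewrite expect_sum.
    apply Rle_trans with (sum (ts A) (fun _ => p ^ length (sel A))).
    + apply sum_le. intros w _. eapply Rle_trans.
      * apply expect_contains_le; [lra | apply NoDup_grid].
      * apply Req_le. f_equal. apply length_map.
    + rewrite sum_const. unfold ts. rewrite length_prod, mult_INR, !length_tuples, !length_seq. lra.
Qed.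

(** * Second moment bound *)

Definition ctrue (l : list bool) : nat := length (filter (fun b => b) l).

Definition agree (t t' : list nat) : list bool :=
  map (fun w => Nat.eqb (fst w) (snd w)) (combine t t').

Lemma nth_agree t t' i : length t = length t' -> (i < length t)%nat ->
  nth i (agree t t') false = Nat.eqb (nth i t 0%nat) (nth i t' 0%nat).
Proof.
  revert t' i. induction t as [|v t IH]; intros [|v' t'] [|i]; simpl; intros Hl Hi; try lia; auto.
  injection Hl as Hl. rewrite <- IH by (auto; lia). reflexivity.
Qed.

(** At most one element equals [v]. Counting the others by the full length amounts to bounding the
    probability of disagreement by 1. *)
Lemma sum_eqb_le (l : list nat) v (G : bool -> R) :
  NoDup l -> (forall b, 0 <= G b) ->
  sum l (fun v' => G (Nat.eqb v v')) <= G true + INR (length l) * G false.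
Proof.
  intros Hn HG. assert (H1 := HG true). assert (H2 := HG false).
  induction l as [|x l IH]; [unfold sum; simpl; lra |].
  inversion_clear Hn as [|? ? Hx Hn']. specialize (IH Hn'). unfold sum. cbn [map fold_right length].
  fold (sum l (fun v' => G (Nat.eqb v v'))). rewrite S_INR.
  destruct (Nat.eqb_spec v x) as [->|_]; [|lra].
  rewrite (sum_ext l _ (fun _ => G false)); [rewrite sum_const; lra |].
  intros y Hy. destruct (Nat.eqb_spec x y); congruence.
Qed.

(* Two independent uniform tuples agree at each place with probability 1/n. *)
Lemma sum_agree_le n k (F : list bool -> R) :
  (1 <= n)%nat -> (forall I, 0 <= F I) ->
  sum (tuples (seq 0 n) k) (fun t => sum (tuples (seq 0 n) k) (fun t' => F (agree t t')))
  <= INR n ^ k * INR n ^ k * sum (tuples [true; false] k) (fun I => (/ INR n) ^ ctrue I * F I).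
Proof.
  intros Hn. assert (Hn' : 0 < INR n) by (apply lt_0_INR; lia).
  revert F. induction k as [|k IH]; intros F HF.
  { unfold sum, agree, ctrue. simpl. lra. }
  rewrite sum_tuples_succ.
  set (Ts := tuples (seq 0 n) k) in *. set (Bs := tuples [true; false] k) in *.
  set (G := fun b : bool => INR n ^ k * INR n ^ k *
                sum Bs (fun I => (/ INR n) ^ ctrue I * F (b :: I))).
  assert (HG : forall b, 0 <= G b).
  { intros b. apply Rmult_le_pos.
    - apply Rmult_le_pos; apply pow_le; lra.
    - apply sum_nonneg. intros I _. apply Rmult_le_pos; auto.
      apply pow_le. left. now apply Rinv_0_lt_compat. }
  apply Rle_trans with (sum (seq 0 n) (fun v => sum (seq 0 n) (fun v' => G (Nat.eqb v v')))).
  - apply sum_le. intros v _.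
    rewrite (sum_ext Ts _ (fun t => sum (seq 0 n) (fun v' =>
               sum Ts (fun t' => F (Nat.eqb v v' :: agree t t'))))).
    2:{ intros t _. now rewrite sum_tuples_succ. }
    rewrite sum_swap. apply sum_le. intros v' _.
    apply (IH (fun I => F (Nat.eqb v v' :: I))). auto.
  - apply Rle_trans with (sum (seq 0 n) (fun _ => G true + INR n * G false)).
    + apply sum_le. intros v _.
      assert (H := sum_eqb_le (seq 0 n) v G (seq_NoDup _ _) HG). now rewrite length_seq in H.
    + rewrite sum_const, length_seq, sum_tuples_succ. fold Bs. unfold sum at 1. simpl.
      unfold ctrue. simpl. fold ctrue.
      rewrite (sum_ext Bs (fun t => / INR n * _ * _)
         (fun t => / INR n * ((/ INR n) ^ ctrue t * F (true :: t)))).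
      2:{ intros. unfold ctrue. ring. }
      rewrite sum_scal. unfold G, ctrue. apply Req_le. field. lra.
Qed.

(** For the agreement patterns [I], [J] of two choices, these are the points of [A] that both copies
    put at the same place. *)
Definition overlap (A : list pt) (I J : list bool) : list pt :=
  filter (fun q => nth (fst q) I false && nth (snd q) J false)%bool A.

(** A bound for the normalised second moment, grouped by the places where two independent copies
    agree: an agreement has probability [1/n] or [1/m], and each shared point gains a factor
    [1/p]. *)
Definition second_moment (A : list pt) (K n m : nat) (p : R) : R :=
  sum (tuples [true; false] K) (fun I => sum (tuples [true; false] K) (fun J =>
    (/ INR n) ^ ctrue I * (/ INR m) ^ ctrue J * (/ p) ^ length (overlap A I J))).

(* Column [i] goes to the [t_i]-th element of the [i]-th block of [n] consecutive columns. *)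
Definition blow (n : nat) (t : list nat) (i : nat) : nat := i * n + nth i t 0%nat.

Lemma blow_inj n k t t' i i' :
  In t (tuples (seq 0 n) k) -> In t' (tuples (seq 0 n) k) -> (i < k)%nat -> (i' < k)%nat ->
  blow n t i = blow n t' i' -> i = i' /\ nth i t 0%nat = nth i' t' 0%nat.
Proof.
  rewrite !in_tuples. intros [H1 H2] [H3 H4] Hi Hi' E. unfold blow in E.
  assert (Ha : In (nth i t 0%nat) (seq 0 n)) by (apply H2, nth_In; lia).
  assert (Hb : In (nth i' t' 0%nat) (seq 0 n)) by (apply H4, nth_In; lia).
  apply in_seq in Ha, Hb.
  assert (i = i'); [|subst; lia].
  destruct (Nat.lt_total i i') as [H|[H|H]]; auto;
  apply (Nat.mul_le_mono_r _ _ n) in H; simpl in H; lia.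
Qed.

Lemma blow_lt n k N t i :
  In t (tuples (seq 0 n) k) -> (i < k)%nat -> (k * n <= N)%nat -> (blow n t i < N)%nat.
Proof.
  rewrite in_tuples. intros [H1 H2] Hi HN. unfold blow.
  assert (Ha : In (nth i t 0%nat) (seq 0 n)) by (apply H2, nth_In; lia).
  apply in_seq in Ha. apply (Nat.mul_le_mono_r _ _ n) in Hi. simpl in Hi. lia.
Qed.

Definition blowup (n m : nat) (t u : list nat) (q : pt) : pt :=
  (blow n t (fst q), blow m u (snd q)).

(** Blocks are disjoint, so a common point of the two copies is the image of a single point of [A]
    at which both choices agree. The first copy and the second copy of the remainder [D] are
    therefore disjoint. *)
Lemma pair_expect_le A K n m N M p t u t' u' :
  NoDup A -> incl A (grid K K) -> (K * n <= N)%nat -> (K * m <= M)%nat -> 0 < p <= 1 ->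
  In t (tuples (seq 0 n) K) -> In t' (tuples (seq 0 n) K) ->
  In u (tuples (seq 0 m) K) -> In u' (tuples (seq 0 m) K) ->
  expect p (grid N M) (fun S => indic (incl (map (blowup n m t u) A) S) *
                                indic (incl (map (blowup n m t' u') A) S))
  <= p ^ length A * p ^ length A * (/ p) ^ length (overlap A (agree t t') (agree u u')).
Proof.
  intros HA HAK HN HM Hp Ht Ht' Hu Hu'.
  assert (HAk : forall q, In q A -> (fst q < K /\ snd q < K)%nat).
  { intros [x y] Hq. now apply in_grid, HAK. }
  assert (Hinj : forall s s' w w' q q', In s (tuples (seq 0 n) K) -> In s' (tuples (seq 0 n) K) ->
     In w (tuples (seq 0 m) K) -> In w' (tuples (seq 0 m) K) -> In q A -> In q' A ->
     blowup n m s w q = blowup n m s' w' q' ->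
     q = q' /\ nth (fst q) s 0%nat = nth (fst q) s' 0%nat /\
     nth (snd q) w 0%nat = nth (snd q) w' 0%nat).
  { intros s s' w w' q q' Hs Hs' Hw Hw' Hq Hq' E. injection E as E1 E2.
    destruct (HAk q Hq), (HAk q' Hq').
    apply (blow_inj n K) in E1; auto. apply (blow_inj m K) in E2; auto.
    destruct E1 as [E1 E1'], E2 as [E2 E2']. destruct q as [x y], q' as [x' y']. simpl in *.
    subst. auto. }
  set (ov := fun q : pt => (nth (fst q) (agree t t') false && nth (snd q) (agree u u') false)%bool).
  set (D := filter (fun q => negb (ov q)) A).
  set (C := map (blowup n m t u) A ++ map (blowup n m t' u') D).
  assert (HC : NoDup C).
  { apply NoDup_app.
    - apply FinFun.Injective_map_NoDup_in; auto. intros q q' Hq Hq' E.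
      now apply (Hinj t t u u) in E.
    - apply FinFun.Injective_map_NoDup_in; [|now apply NoDup_filter].
      intros q q' Hq Hq' E. apply filter_In in Hq, Hq'. now apply (Hinj t' t' u' u') in E.
    - intros x H1 H2. apply in_map_iff in H1, H2. destruct H1 as (q & <- & Hq).
      destruct H2 as (q' & E & Hq'). apply filter_In in Hq'. destruct Hq' as [Hq' Hov].
      symmetry in E. apply Hinj in E; auto. destruct E as (<- & E1 & E2).
      destruct (HAk q Hq) as [Hk1 Hk2]. unfold ov in Hov.
      pose proof (proj1 (in_tuples _ _ _) Ht) as [L1 _].
      pose proof (proj1 (in_tuples _ _ _) Ht') as [L2 _].
      pose proof (proj1 (in_tuples _ _ _) Hu) as [L3 _].
      pose proof (proj1 (in_tuples _ _ _) Hu') as [L4 _].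
      rewrite !nth_agree in Hov by lia. rewrite E1, E2, !Nat.eqb_refl in Hov. discriminate. }
  assert (HCg : incl C (grid N M)).
  { intros x Hx. apply in_app_or in Hx. destruct Hx as [Hx|Hx]; apply in_map_iff in Hx;
    destruct Hx as (q & <- & Hq); [|apply filter_In in Hq; destruct Hq as [Hq _]];
    destruct (HAk q Hq); apply in_grid; split; eapply blow_lt; eauto. }
  apply Rle_trans with (expect p (grid N M) (fun S => indic (incl C S))).
  - apply expect_le; [lra |]. intros S _. rewrite indic_and. apply indic_le.
    intros [H1 H2]. apply incl_app; auto. intros x Hx. apply H2.
    apply in_map_iff in Hx. destruct Hx as (q & <- & Hq). apply filter_In in Hq. now apply in_map.
  - rewrite expect_contains; auto using NoDup_grid. apply Req_le.
    assert (E : (length (overlap A (agree t t') (agree u u')) + length D = length A)%nat)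
      by exact (filter_length ov A).
    assert (EC : (length C = length A + length D)%nat)
      by (unfold C; rewrite length_app; f_equal; apply length_map).
    rewrite EC, <- E, !pow_add, pow_inv. field. apply pow_nonzero. lra.
Qed.

Lemma second_moment_pos A K n m p :
  (1 <= n)%nat -> (1 <= m)%nat -> 0 < p -> 0 < second_moment A K n m p.
Proof.
  intros Hn Hm Hp.
  assert (Hn' : 0 < / INR n) by (apply Rinv_0_lt_compat, lt_0_INR; lia).
  assert (Hm' : 0 < / INR m) by (apply Rinv_0_lt_compat, lt_0_INR; lia).
  assert (Hp' := Rinv_0_lt_compat _ Hp).
  assert (Hpos : forall I J, 0 < (/ INR n) ^ ctrue I * (/ INR m) ^ ctrue J *
     (/ p) ^ length (overlap A I J)).
  { intros. repeat apply Rmult_lt_0_compat; now apply pow_lt. }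
  assert (HF : In (repeat false K) (tuples [true; false] K)).
  { apply in_tuples. rewrite repeat_length. split; auto.
    intros b Hb. apply repeat_spec in Hb. subst. simpl. auto. }
  eapply Rlt_le_trans; [apply (Hpos (repeat false K) (repeat false K)) |].
  eapply Rle_trans; [|apply (sum_ge_term _ _ (repeat false K)); auto].
  - refine (sum_ge_term _ (fun J => (/ INR n) ^ ctrue (repeat false K) * (/ INR m) ^ ctrue J *
      (/ p) ^ length (overlap A (repeat false K) J)) _ _ HF). intros. left. auto.
  - intros. apply sum_nonneg. intros. left. auto.
Qed.

(* Second moment method: with Y the normalised number of blown-up copies of A in the
   random set, E Y = 1 and E Y^2 <= W, and 1_{Y > 0} >= 2 Y / W - Y^2 / W^2. *)
Lemma Pspan_ge_second_moment Z A K n m N M p :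
  NoDup A -> incl A (grid K K) -> spans Z (fun x => In x A) ->
  (1 <= n)%nat -> (1 <= m)%nat -> (K * n <= N)%nat -> (K * m <= M)%nat -> 0 < p <= 1 ->
  / second_moment A K n m p <= Pspan Z N M p.
Proof.
  intros HA HAK HsA Hn Hm HN HM Hp.
  set (W := second_moment A K n m p).
  assert (HW : 0 < W) by (apply second_moment_pos; auto; lra).
  assert (Hn' : 0 < INR n) by (apply lt_0_INR; lia).
  assert (Hm' : 0 < INR m) by (apply lt_0_INR; lia).
  set (Tn := tuples (seq 0 n) K). set (Tm := tuples (seq 0 m) K).
  set (hit := fun (w : list nat * list nat) S => indic (incl (map (blowup n m (fst w) (snd w)) A) S)).
  (* Reciprocal of the expected number of copies, so that [c * X S] has mean 1. *)
  set (c := / (INR n ^ K * INR m ^ K * p ^ length A)).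
  assert (Hden : 0 < INR n ^ K * INR m ^ K * p ^ length A).
  { repeat apply Rmult_lt_0_compat; apply pow_lt; lra. }
  set (X := fun S => sum (list_prod Tn Tm) (fun w => hit w S)).
  assert (HAk : forall q, In q A -> (fst q < K /\ snd q < K)%nat).
  { intros [x y] Hq. now apply in_grid, HAK. }
  assert (HEX : expect p (grid N M) X = / c).
  { unfold X, c. rewrite expect_sum.
    rewrite (sum_ext _ _ (fun _ => p ^ length A)).
    - rewrite sum_const, length_prod, mult_INR. unfold Tn, Tm.
      rewrite !length_tuples, !length_seq, Rinv_inv. reflexivity.
    - intros [t u] Hw. apply in_prod_iff in Hw. destruct Hw as [Ht Hu]. unfold hit. simpl.
      rewrite expect_contains, length_map; auto using NoDup_grid.
      + apply FinFun.Injective_map_NoDup_in; auto. intros q q' Hq Hq' E. injection E as E1 E2.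
        destruct (HAk q Hq), (HAk q' Hq').
        apply (blow_inj n K) in E1; auto. apply (blow_inj m K) in E2; auto.
        destruct q, q'. simpl in *. destruct E1, E2. congruence.
      + intros x Hx. apply in_map_iff in Hx. destruct Hx as (q & <- & Hq).
        destruct (HAk q Hq). apply in_grid. split; eapply blow_lt; eauto. }
  assert (HEX2 : expect p (grid N M) (fun S => X S * X S) <= / c * / c * W).
  { unfold X. erewrite expect_ext by (intros S _; apply sum_mult).
    rewrite expect_sum, sum_prod.
    apply Rle_trans with (p ^ length A * p ^ length A *
      sum Tn (fun t => sum Tm (fun u => sum Tn (fun t' => sum Tm (fun u' =>
        (/ p) ^ length (overlap A (agree t t') (agree u u'))))))).
    - rewrite <- sum_scal. apply sum_le. intros t Ht.
      rewrite <- sum_scal. apply sum_le. intros u Hu.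
      rewrite expect_sum, sum_prod.
      rewrite <- sum_scal. apply sum_le. intros t' Ht'.
      rewrite <- sum_scal. apply sum_le. intros u' Hu'.
      apply (pair_expect_le A K n m N M p t u t' u'); auto.
    - assert (Hpi : 0 < / p) by (apply Rinv_0_lt_compat; lra).
      (* Pairing the two column choices and the two row choices allows agreements to be bounded in
         one direction at a time. *)
      rewrite (sum_ext Tn _ (fun t => sum Tn (fun t' => sum Tm (fun u => sum Tm (fun u' =>
        (/ p) ^ length (overlap A (agree t t') (agree u u')))))));
        [|intros; apply sum_swap].
      set (F := fun I => sum Tm (fun u => sum Tm (fun u' =>
                 (/ p) ^ length (overlap A I (agree u u'))))).
      assert (HF : forall I, 0 <= F I).
      { intros I. apply sum_nonneg. intros. apply sum_nonneg. intros. apply pow_le. lra. }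
      assert (H1 := sum_agree_le n K F Hn HF). fold Tn in H1.
      assert (H2 : sum (tuples [true; false] K) (fun I => (/ INR n) ^ ctrue I * F I) <=
                   INR m ^ K * INR m ^ K * W).
      { unfold W, second_moment. rewrite <- sum_scal. apply sum_le. intros I _.
        assert (H := sum_agree_le m K (fun J => (/ p) ^ length (overlap A I J)) Hm).
        fold Tm in H. unfold F.
        assert (Hw : 0 <= (/ INR n) ^ ctrue I).
        { apply pow_le. left. now apply Rinv_0_lt_compat. }
        eapply Rle_trans; [apply Rmult_le_compat_l; [exact Hw | apply H] |].
        - intros J. apply pow_le. lra.
        - apply Req_le.
          rewrite (sum_ext _ (fun J => (/ INR n) ^ ctrue I * _ * _)
            (fun J => (/ INR n) ^ ctrue I *
               ((/ INR m) ^ ctrue J * (/ p) ^ length (overlap A I J)))) by (intros; ring).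
          rewrite sum_scal. ring. }
      unfold c. rewrite Rinv_inv.
      assert (Hnn : 0 <= INR n ^ K * INR n ^ K) by (apply Rmult_le_pos; apply pow_le; lra).
      assert (Hpp : 0 <= p ^ length A * p ^ length A) by (apply Rmult_le_pos; apply pow_le; lra).
      eapply Rle_trans; [apply Rmult_le_compat_l; [exact Hpp | exact H1] |].
      eapply Rle_trans; [apply Rmult_le_compat_l; [exact Hpp |
        apply Rmult_le_compat_l; [exact Hnn | exact H2]] |].
      apply Req_le. ring. }
  assert (Hc : 0 < c) by (unfold c; now apply Rinv_0_lt_compat).
  assert (HWi := Rinv_0_lt_compat _ HW).
  apply Rle_trans with (expect p (grid N M) (fun S =>
     (2 * / W * c) * X S + (- (/ W * / W * c * c)) * (X S * X S))).
  - rewrite expect_plus, !expect_scal, HEX.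
    apply Rle_trans with (2 * / W * c * / c + - (/ W * / W * c * c) * (/ c * / c * W)).
    + apply Req_le. field. lra.
    + apply Rplus_le_compat_l. rewrite !Ropp_mult_distr_l_reverse. apply Ropp_le_contravar.
      apply Rmult_le_compat_l; auto. repeat apply Rmult_le_pos; lra.
  - rewrite Pspan_expect. apply expect_le; [lra |]. intros S _.
    destruct (classic (spans Z (fun x => In x S))) as [Hs|Hs].
    + rewrite indic_true by auto. assert (H := pow2_ge_0 (/ W * c * X S - 1)). nra.
    + rewrite indic_false by auto.
      (* A contained copy would make [S] span by [spans_embed], so here no copy is contained. *)
      assert (E : X S = 0); [|rewrite E; lra].
      unfold X. rewrite (sum_ext _ _ (fun _ => 0)); [rewrite sum_const; ring |].
      intros [t u] Hw. apply in_prod_iff in Hw. destruct Hw as [Ht Hu].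
      apply indic_false. intros Hi. apply Hs. simpl in Hi.
      apply (spans_embed Z (blow n t) (blow m u) (seq 0 K) (seq 0 K) (fun x => In x A));
        auto using seq_NoDup.
      * apply FinFun.Injective_map_NoDup_in; [|apply seq_NoDup].
        intros x y Hx Hy E. apply in_seq in Hx, Hy. apply (blow_inj n K) in E; auto; [tauto | lia | lia].
      * apply FinFun.Injective_map_NoDup_in; [|apply seq_NoDup].
        intros x y Hx Hy E. apply in_seq in Hx, Hy. apply (blow_inj m K) in E; auto; [tauto | lia | lia].
      * intros x y Hxy. destruct (HAk _ Hxy). simpl in *. rewrite !in_seq. repeat split; try lia.
        apply Hi. now apply (in_map (blowup n m t u)) in Hxy.
Qed.

(** * Small-p asymptotics *)

(** Eventually as [p] decreases to 0. The quantifiers match those of [lim0] and [to_infty0], which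
    therefore serve directly as [ev] facts. *)
Definition ev (P : R -> Prop) : Prop :=
  exists delta, delta > 0 /\ forall p, 0 < p < delta -> P p.

Lemma ev_and P Q : ev P -> ev Q -> ev (fun p => P p /\ Q p).
Proof.
  intros (d1 & H1 & H1') (d2 & H2 & H2'). exists (Rmin d1 d2).
  split; [now apply Rmin_glb_lt |]. intros p Hp.
  assert (A1 := Rmin_l d1 d2). assert (A2 := Rmin_r d1 d2).
  split; [apply H1' | apply H2']; lra.
Qed.

Lemma ev_impl (P Q : R -> Prop) : (forall p, 0 < p -> P p -> Q p) -> ev P -> ev Q.
Proof. intros H (d & Hd & Hd'). exists d. split; auto. intros p Hp. apply H; [lra | auto]. Qed.

Lemma ev_forall {X : Type} (l : list X) (P : X -> R -> Prop) :
  (forall x, In x l -> ev (P x)) -> ev (fun p => forall x, In x l -> P x p).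
Proof.
  induction l as [|y l IH]; intros H.
  - exists 1. split; [lra |]. intros p _ x [].
  - assert (H1 := H y (or_introl eq_refl)).
    assert (H2 : ev (fun p => forall x, In x l -> P x p)) by (apply IH; intros; apply H; now right).
    eapply ev_impl; [|exact (ev_and _ _ H1 H2)].
    intros p _ [E1 E2] x [<-|Hx]; auto.
Qed.

Lemma ev_lt d : 0 < d -> ev (fun p => p < d).
Proof. intros H. exists d. split; auto. intros p Hp. lra. Qed.

Lemma ev_neg_ln C : ev (fun p => C < - ln p).
Proof.
  exists (exp (- C)). split; [apply exp_pos |]. intros p [Hp Hp'].
  assert (H := ln_increasing _ _ Hp Hp'). rewrite ln_exp in H. lra.
Qed.

Lemma ev_scale_bounds alpha N eps :
  lim0 (fun p => ln (INR (N p)) / ln p) (- alpha) -> 0 < eps ->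
  ev (fun p => (alpha - eps) * - ln p <= ln (INR (N p)) <= (alpha + eps) * - ln p).
Proof.
  intros H Heps. specialize (H eps Heps).
  eapply ev_impl; [|exact (ev_and _ _ H (ev_neg_ln 0))].
  intros p _ [H1 H2]. apply Rabs_def2 in H1. destruct H1 as [H1 H3].
  set (x := ln (INR (N p))) in *.
  assert (E : x / ln p * - ln p = - x) by (field; lra). nra.
Qed.

(** The divisor [S K] is nonzero even for [K = 0]. Division and rounding lose at most a factor
    [2 * S K], which half of [eps] absorbs once [- ln p] is large. *)
Lemma ev_block_bounds alpha N K eps :
  to_infty0 N -> lim0 (fun p => ln (INR (N p)) / ln p) (- alpha) -> 0 < eps ->
  ev (fun p => (1 <= N p / S K)%nat /\ (S K * (N p / S K) <= N p)%nat /\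
     (alpha - eps) * - ln p <= ln (INR (N p / S K))).
Proof.
  intros Hinf Hl Heps.
  assert (Heps2 : 0 < eps / 2) by lra.
  assert (H1 := ev_scale_bounds alpha N (eps / 2) Hl Heps2).
  assert (H2 := ev_neg_ln (ln (INR (2 * S K)) * (2 / eps))).
  assert (H3 : ev (fun p => (S K <= N p)%nat)) by apply Hinf.
  eapply ev_impl; [|exact (ev_and _ _ H1 (ev_and _ _ H2 H3))].
  intros p Hp (E1 & E2 & E3).
  assert (Hn : (1 <= N p / S K)%nat) by (apply Nat.div_le_lower_bound; lia).
  assert (Hm := Nat.Div0.mul_div_le (N p) (S K)).
  split; auto. split; auto.
  assert (Hup := Nat.mul_succ_div_gt (N p) (S K) ltac:(lia)).
  assert (H4 : (N p <= 2 * S K * (N p / S K))%nat) by nia.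
  apply le_INR in H4. rewrite mult_INR in H4.
  assert (P1 : 0 < INR (N p)) by (apply lt_0_INR; lia).
  assert (P2 : 0 < INR (2 * S K)) by (apply lt_0_INR; lia).
  assert (P3 : 0 < INR (N p / S K)) by (apply lt_0_INR; lia).
  assert (H5 : ln (INR (N p)) <= ln (INR (2 * S K)) + ln (INR (N p / S K))).
  { rewrite <- ln_mult by auto. destruct H4 as [H4|H4]; [left; now apply ln_increasing |].
    right. now rewrite H4. }
  assert (H6 : ln (INR (2 * S K)) <= - ln p * (eps / 2)).
  { apply (Rmult_le_reg_r (2 / eps)); [apply Rdiv_lt_0_compat; lra |].
    replace (- ln p * (eps / 2) * (2 / eps)) with (- ln p) by (field; lra). lra. }
  lra.
Qed.

Lemma pow_exp x n : 0 < x -> x ^ n = exp (INR n * ln x).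
Proof. intros Hx. rewrite <- (Rpower_pow n x Hx). reflexivity. Qed.

Lemma exp_le x y : x <= y -> exp x <= exp y.
Proof. intros [H| ->]; [left; now apply exp_increasing | lra]. Qed.

Lemma ln_le x y : 0 < x -> x <= y -> ln x <= ln y.
Proof. intros Hx [H| ->]; [left; now apply ln_increasing | lra]. Qed.

Lemma first_moment_term a b (B : list pt) N M p delta :
  0 < p -> 0 < - ln p -> (1 <= N)%nat -> (1 <= M)%nat ->
  ln (INR N) <= (a + delta) * - ln p -> ln (INR M) <= (b + delta) * - ln p ->
  INR N ^ card (map fst B) * INR M ^ card (map snd B) * p ^ length B <=
  exp (- ln p * (- val a b B + delta * (INR (card (map fst B)) + INR (card (map snd B))))).
Proof.
  intros Hp HL HN HM H1 H2. rewrite !pow_exp; auto; try (apply lt_0_INR; lia).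
  rewrite <- !exp_plus. apply exp_le. unfold val.
  assert (H3 := pos_INR (card (map fst B))). assert (H4 := pos_INR (card (map snd B))).
  apply (Rmult_le_compat_l _ _ _ H3) in H1. apply (Rmult_le_compat_l _ _ _ H4) in H2. lra.
Qed.

(** As [ln p] is negative, an upper bound on the probability bounds the quotient from below. The
    positivity premise for the logarithm is supplied by [Pspan_lower]. *)
Lemma Pspan_upper Z K a b N M eps :
  finite_set Z -> small_copies Z K -> ld_regime a b N M -> 0 < eps ->
  ev (fun p => 0 < Pspan Z (N p) (M p) p ->
      rate (small_spanning Z K) a b - eps < ln (Pspan Z (N p) (M p) p) / ln p).
Proof.
  intros Hf HK (HN & HM & HlN & HlM) Heps.
  set (D := INR (K * K)). assert (HD : 0 <= D) by apply pos_INR.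
  (* Half of [eps] pays for an error [delta] in each of at most [D] columns and [D] rows; the other
     half pays for the number of patterns. *)
  set (delta := eps / (4 * D + 1)).
  assert (Hdelta : 0 < delta) by (apply Rdiv_lt_0_compat; lra).
  assert (Ed : delta * (4 * D + 1) = eps) by (unfold delta; field; lra).
  set (A0 := small_spanning Z K).
  assert (HA0 : 0 < INR (length A0)).
  { apply lt_0_INR. assert (H := small_spanning_nonempty Z K Hf HK).
    fold A0 in H. destruct A0; [congruence | simpl; lia]. }
  assert (E1 := ev_scale_bounds a N delta HlN Hdelta).
  assert (E2 := ev_scale_bounds b M delta HlM Hdelta).
  assert (E3 := ev_neg_ln 0).
  assert (E4 := ev_neg_ln (ln (INR (length A0)) * (2 / eps))).
  assert (E5 := ev_lt 1 Rlt_0_1).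
  eapply ev_impl; [|exact (ev_and _ _ E1 (ev_and _ _ E2 (ev_and _ _ E3
    (ev_and _ _ E4 (ev_and _ _ E5 (ev_and _ _ (HN 1%nat) (HM 1%nat)))))))].
  clear E1 E2 E3 E4 E5. intros p Hp (E1 & E2 & E3 & E4 & E5 & E6 & E7) HP.
  set (sel := fun A => proj1_sig (constructive_indefinite_description _ (rho_attained a b A))).
  assert (Hsel : forall A, In (sel A) (sublists A) /\ rho a b A = val a b (sel A)).
  { intros A. exact (proj2_sig (constructive_indefinite_description _ (rho_attained a b A))). }
  assert (HU := Pspan_le_copies Z K (N p) (M p) p sel HK ltac:(lra) (fun A => proj1 (Hsel A))).
  set (r := rate A0 a b).
  assert (HU2 : Pspan Z (N p) (M p) p <= INR (length A0) * exp (- ln p * (- r + eps / 2))).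
  { eapply Rle_trans; [exact HU |]. fold A0. rewrite <- sum_const. apply sum_le. intros A HA.
    destruct (Hsel A) as [Hs1 Hs2].
    eapply Rle_trans; [apply (first_moment_term a b (sel A) _ _ p delta); auto; lra |].
    apply exp_le, Rmult_le_compat_l; [lra |].
    assert (Hr := rate_le A0 a b A HA). fold r in Hr.
    assert (C1 := card_map_le_length fst (sel A)). assert (C2 := card_map_le_length snd (sel A)).
    assert (C3 := sublists_length _ _ Hs1). assert (C4 := small_spanning_length Z K A HA).
    assert (C5 : INR (card (map fst (sel A))) <= D) by (apply le_INR; lia).
    assert (C6 : INR (card (map snd (sel A))) <= D) by (apply le_INR; lia).
    rewrite Hs2 in Hr. nra. }
  apply (ln_le _ _ HP) in HU2. rewrite ln_mult, ln_exp in HU2 by auto using exp_pos.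
  assert (E8 : ln (INR (length A0)) < - ln p * (eps / 2)).
  { apply (Rmult_lt_reg_r (2 / eps)); [apply Rdiv_lt_0_compat; lra |].
    replace (- ln p * (eps / 2) * (2 / eps)) with (- ln p) by (field; lra). lra. }
  set (x := ln (Pspan Z (N p) (M p) p)) in *.
  apply (Rmult_lt_reg_r (- ln p)); auto.
  replace (x / ln p * - ln p) with (- x) by (field; lra). fold r. nra.
Qed.

Lemma filter_nth_length (I : list bool) :
  length (filter (fun i => nth i I false) (seq 0 (length I))) = ctrue I.
Proof.
  unfold ctrue. induction I as [|b I IH]; auto.
  cbn [length seq]. rewrite <- seq_shift. simpl.
  assert (E : length (filter (fun i => match i with 0%nat => b | S m => nth m I false end)
            (map S (seq 0 (length I)))) = length (filter (fun i => nth i I false) (seq 0 (length I)))).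
  { generalize (seq 0 (length I)). intros l. induction l as [|x l IHl]; auto.
    simpl. destruct (nth x I false); simpl; now rewrite IHl. }
  destruct b; simpl; rewrite E, IH; reflexivity.
Qed.

Lemma card_le_ctrue l I : (forall x, In x l -> nth x I false = true) -> (card l <= ctrue I)%nat.
Proof.
  intros H. rewrite <- filter_nth_length. apply NoDup_incl_length; [apply NoDup_nodup |].
  intros x Hx. apply nodup_In in Hx. apply H in Hx. apply filter_In. split; auto.
  apply in_seq. split; [lia |]. simpl.
  destruct (le_lt_dec (length I) x) as [Hle|]; auto. rewrite nth_overflow in Hx by auto. discriminate.
Qed.

Lemma ctrue_le I K : In I (tuples [true; false] K) -> (ctrue I <= K)%nat.
Proof. rewrite in_tuples. intros [<- _]. apply filter_length_le. Qed.

Definition moment_term (A : list pt) (n m : nat) (p : R) (I J : list bool) : R :=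
  (/ INR n) ^ ctrue I * (/ INR m) ^ ctrue J * (/ p) ^ length (overlap A I J).

(** The overlap meets only flagged lines, perhaps not all of them. Since [a] and [b] are
    nonnegative, replacing [ctrue] by the projection counts only raises the exponent; each flagged
    line adds an error [delta]. *)
Lemma moment_term_le a b A K n m p delta I J :
  quadrant a b -> 0 < p -> 0 < - ln p -> (1 <= n)%nat -> (1 <= m)%nat -> 0 <= delta ->
  (a - delta) * - ln p <= ln (INR n) -> (b - delta) * - ln p <= ln (INR m) ->
  In I (tuples [true; false] K) -> In J (tuples [true; false] K) ->
  moment_term A n m p I J <=
  exp (- ln p * (val a b (overlap A I J) + delta * (2 * INR K))).
Proof.
  intros [Ha Hb] Hp HL Hn Hm Hd H1 H2 HI HJ. unfold moment_term.
  assert (Hn' : 0 < INR n) by (apply lt_0_INR; lia).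
  assert (Hm' : 0 < INR m) by (apply lt_0_INR; lia).
  rewrite !pow_exp by now apply Rinv_0_lt_compat.
  rewrite !ln_Rinv, <- !exp_plus by auto. apply exp_le. unfold val.
  set (B := overlap A I J).
  assert (C1 : (card (map fst B) <= ctrue I)%nat).
  { apply card_le_ctrue. intros x Hx. apply in_map_iff in Hx. destruct Hx as (q & <- & Hq).
    apply filter_In in Hq. now apply proj2, Bool.andb_true_iff, proj1 in Hq. }
  assert (C2 : (card (map snd B) <= ctrue J)%nat).
  { apply card_le_ctrue. intros x Hx. apply in_map_iff in Hx. destruct Hx as (q & <- & Hq).
    apply filter_In in Hq. now apply proj2, Bool.andb_true_iff, proj2 in Hq. }
  apply le_INR in C1, C2. assert (C3 := ctrue_le I K HI). assert (C4 := ctrue_le J K HJ).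
  apply le_INR in C3, C4.
  assert (P1 := pos_INR (ctrue I)). assert (P2 := pos_INR (ctrue J)).
  apply (Rmult_le_compat_l _ _ _ P1) in H1. apply (Rmult_le_compat_l _ _ _ P2) in H2.
  apply (Rmult_le_compat_l _ _ _ Ha) in C1. apply (Rmult_le_compat_l _ _ _ Hb) in C2.
  apply (Rmult_le_compat_l _ _ _ Hd) in C3. apply (Rmult_le_compat_l _ _ _ Hd) in C4.
  nra.
Qed.

Lemma incl_grid_succ K A : incl A (grid K K) -> incl A (grid (S K) (S K)).
Proof. intros H [x y] Hq. apply H, in_grid in Hq. apply in_grid. lia. Qed.

(** Every overlap is a subpattern of [A], so each of the [Q * Q] terms of the second moment is at
    most about [p^(-rho)], and [ln (Q * Q)] is negligible against [- ln p]. *)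
Lemma Pspan_lower Z K A a b N M eps :
  In A (small_spanning Z K) -> quadrant a b -> ld_regime a b N M -> 0 < eps ->
  ev (fun p => 0 < Pspan Z (N p) (M p) p /\
      ln (Pspan Z (N p) (M p) p) / ln p < rho a b A + eps).
Proof.
  intros HA Hq (HN & HM & HlN & HlM) Heps.
  set (D := 2 * INR (S K)). assert (HD : 0 <= D) by (unfold D; assert (H := pos_INR (S K)); lra).
  set (delta := eps / (2 * D + 1)).
  assert (Hdelta : 0 < delta) by (apply Rdiv_lt_0_compat; lra).
  assert (Ed : delta * (2 * D + 1) = eps) by (unfold delta; field; lra).
  set (Q := INR (length (tuples [true; false] (S K)))).
  assert (HQ : 0 < Q).
  { unfold Q. rewrite length_tuples. apply pow_lt. simpl. lra. }
  assert (E1 := ev_block_bounds a N K delta HN HlN Hdelta).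
  assert (E2 := ev_block_bounds b M K delta HM HlM Hdelta).
  assert (E3 := ev_neg_ln 0).
  assert (E4 := ev_neg_ln (ln (Q * Q) * (2 / eps))).
  assert (E5 := ev_lt 1 Rlt_0_1).
  eapply ev_impl; [|exact (ev_and _ _ E1 (ev_and _ _ E2 (ev_and _ _ E3 (ev_and _ _ E4 E5))))].
  clear E1 E2 E3 E4 E5. intros p Hp ((E1 & E1' & E1'') & (E2 & E2' & E2'') & E3 & E4 & E5).
  set (n := (N p / S K)%nat) in *. set (m := (M p / S K)%nat) in *.
  assert (HAs := HA). apply small_spanning_iff in HAs. destruct HAs as [HAg HAs].
  assert (HL := Pspan_ge_second_moment Z A (S K) n m (N p) (M p) p
    (proj1 (small_spanning_fin Z K A HA)) (incl_grid_succ K A (sublists_incl _ _ HAg)) HAs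
    E1 E2 E1' E2' ltac:(lra)).
  assert (HW : 0 < second_moment A (S K) n m p) by (apply second_moment_pos; auto).
  assert (HWi := Rinv_0_lt_compat _ HW).
  split; [lra |].
  assert (HWle : second_moment A (S K) n m p <= Q * Q * exp (- ln p * (rho a b A + eps / 2))).
  { rewrite Rmult_assoc. unfold Q. rewrite <- !sum_const. apply sum_le. intros I HI.
    apply sum_le. intros J HJ.
    eapply Rle_trans; [apply (moment_term_le a b A (S K) n m p delta I J); auto; lra |].
    apply exp_le, Rmult_le_compat_l; [lra |]. fold D.
    assert (H := rho_ge_sub a b A (overlap A I J) (sublists_filter _ _)). nra. }
  apply (ln_le _ _ HWi) in HL. apply (ln_le _ _ HW) in HWle.
  rewrite ln_Rinv in HL by auto.
  rewrite ln_mult, ln_exp in HWle by (auto using exp_pos; nra).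
  assert (E8 : ln (Q * Q) < - ln p * (eps / 2)).
  { apply (Rmult_lt_reg_r (2 / eps)); [apply Rdiv_lt_0_compat; lra |].
    replace (- ln p * (eps / 2) * (2 / eps)) with (- ln p) by (field; lra). lra. }
  set (x := ln (Pspan Z (N p) (M p) p)) in *.
  apply (Rmult_lt_reg_r (- ln p)); auto.
  replace (x / ln p * - ln p) with (- x) by (field; lra). nra.
Qed.

Lemma rate_is_rate Z K a b :
  finite_set Z -> small_copies Z K -> quadrant a b ->
  rate_is Z a b (rate (small_spanning Z K) a b).
Proof.
  intros Hf HK Hq N M Hld eps Heps.
  destruct (rate_attained _ a b (small_spanning_nonempty Z K Hf HK)) as (A & HA & E).
  assert (H1 := Pspan_lower Z K A a b N M eps HA Hq Hld Heps). rewrite <- E in H1.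
  assert (H2 := Pspan_upper Z K a b N M eps Hf HK Hld Heps).
  destruct (ev_and _ _ H1 H2) as (d & Hd & H). exists d. split; auto. intros p Hp.
  destruct (H p Hp) as [[H3 H4] H5]. specialize (H5 H3). apply Rabs_def1; lra.
Qed.

(** * Spanning with high probability *)

(** Since [0 ^ 0 = 1], the summand is the indicator of the all-false pattern. *)
Lemma sum_zero_pow_ctrue k : sum (tuples [true; false] k) (fun I => 0 ^ ctrue I) = 1.
Proof.
  induction k as [|k IH]; [unfold sum; simpl; ring |].
  rewrite sum_tuples_succ. unfold sum at 1. simpl.
  rewrite (sum_ext _ (fun t => 0 ^ ctrue (true :: t)) (fun _ => 0)), sum_const.
  - unfold ctrue in *. simpl. rewrite IH. ring.
  - intros. unfold ctrue. simpl. ring.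
Qed.

Lemma pow_inv_le x k : 1 <= x -> 0 < (/ x) ^ k <= 1 /\ ((1 <= k)%nat -> (/ x) ^ k <= / x).
Proof.
  intros Hx. assert (Hi : 0 < / x) by (apply Rinv_0_lt_compat; lra).
  assert (Hi1 : / x <= 1) by (rewrite <- Rinv_1; apply Rinv_le_contravar; lra).
  assert (H : forall j, 0 < (/ x) ^ j <= 1).
  { intros j. split; [now apply pow_lt |].
    rewrite <- (pow1 j). apply pow_incr. lra. }
  split; auto. intros Hk. destruct k; [lia |]. simpl.
  specialize (H k). nra.
Qed.

Lemma INR_div_large N K C : to_infty0 N -> ev (fun p => C < INR (N p / S K)).
Proof.
  intros H. destruct (INR_unbounded C) as [c Hc].
  eapply ev_impl; [|exact (H (S K * c)%nat)]. intros p _ Hp. simpl in Hp.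
  assert (c <= N p / S K)%nat by (apply Nat.div_le_lower_bound; simpl; lia).
  apply le_INR in H0. lra.
Qed.

(** With a nonempty overlap the term decays like a power of [p]. With an empty one the decay comes
    from block widths tending to infinity, because for [a = 0] or [b = 0] no power of [p] is
    available. *)
Lemma moment_term_small A K a b N M eps I J :
  (forall B, In B (sublists A) -> B <> [] -> val a b B < 0) ->
  quadrant a b -> ld_regime a b N M -> 0 < eps ->
  In I (tuples [true; false] (S K)) -> In J (tuples [true; false] (S K)) ->
  ev (fun p => moment_term A (N p / S K) (M p / S K) p I J <= 0 ^ ctrue I * 0 ^ ctrue J + eps).
Proof.
  intros Hneg Hq (HN & HM & HlN & HlM) Heps HI HJ.
  assert (Hz : forall k, 0 <= 0 ^ k) by (intros; apply pow_le; lra).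
  assert (Hz2 : 0 <= 0 ^ ctrue I * 0 ^ ctrue J) by (apply Rmult_le_pos; auto).
  destruct (overlap A I J) as [|q B'] eqn:EB.
  - assert (E1 := INR_div_large N K (Rmax 1 (/ eps)) HN).
    assert (E2 := INR_div_large M K (Rmax 1 (/ eps)) HM).
    eapply ev_impl; [|exact (ev_and _ _ E1 E2)]. intros p Hp [F1 F2].
    unfold moment_term. rewrite EB. simpl length. rewrite pow_O, Rmult_1_r.
    assert (M1 := Rmax_l 1 (/ eps)). assert (M2 := Rmax_r 1 (/ eps)).
    assert (Hie := Rinv_0_lt_compat _ Heps).
    assert (I1 : / INR (N p / S K) <= eps).
    { rewrite <- (Rinv_inv eps). apply Rinv_le_contravar; lra. }
    assert (I2 : / INR (M p / S K) <= eps).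
    { rewrite <- (Rinv_inv eps). apply Rinv_le_contravar; lra. }
    destruct (pow_inv_le (INR (N p / S K)) (ctrue I)) as [P1 P1']; [lra |].
    destruct (pow_inv_le (INR (M p / S K)) (ctrue J)) as [P2 P2']; [lra |].
    destruct (Nat.eq_dec (ctrue I) 0) as [Z1|Z1].
    + destruct (Nat.eq_dec (ctrue J) 0) as [Z2|Z2].
      * rewrite Z1, Z2. simpl. lra.
      * specialize (P2' ltac:(lia)). nra.
    + specialize (P1' ltac:(lia)). nra.
  - set (v := val a b (q :: B')).
    assert (Hv : v < 0).
    { apply Hneg; [|discriminate]. rewrite <- EB. apply sublists_filter. }
    set (D := 2 * INR (S K)). assert (HD : 0 <= D) by (unfold D; assert (H := pos_INR (S K)); lra).
    set (delta := (- v) / (2 * D + 1)).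
    assert (Hdelta : 0 < delta) by (apply Rdiv_lt_0_compat; lra).
    assert (Ed : delta * (2 * D + 1) = - v) by (unfold delta; field; lra).
    assert (E1 := ev_block_bounds a N K delta HN HlN Hdelta).
    assert (E2 := ev_block_bounds b M K delta HM HlM Hdelta).
    assert (E3 := ev_neg_ln 0).
    assert (E4 := ev_neg_ln (- ln eps * (2 / - v))).
    eapply ev_impl; [|exact (ev_and _ _ E1 (ev_and _ _ E2 (ev_and _ _ E3 E4)))].
    clear E1 E2 E3 E4. intros p Hp ((E1 & E1' & E1'') & (E2 & E2' & E2'') & E3 & E4).
    eapply Rle_trans; [apply (moment_term_le a b A (S K) _ _ p delta I J); auto; lra |].
    rewrite EB. fold v. fold D.
    apply Rle_trans with eps; [|lra]. rewrite <- (exp_ln eps Heps). apply exp_le.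
    assert (E8 : - ln eps < - ln p * (- v / 2)).
    { apply (Rmult_lt_reg_r (2 / - v)); [apply Rdiv_lt_0_compat; lra |].
      replace (- ln p * (- v / 2) * (2 / - v)) with (- ln p) by (field; lra). lra. }
    nra.
Qed.

(** Only the pattern pair without agreements has a nonzero limit, so the second moment bound is
    eventually close to at most 1, and its reciprocal bounds the probability from below. *)
Lemma Pspan_to_1 Z A K a b N M :
  NoDup A -> incl A (grid K K) -> spans Z (fun x => In x A) ->
  (forall B, In B (sublists A) -> B <> [] -> val a b B < 0) ->
  quadrant a b -> ld_regime a b N M ->
  lim0 (fun p => Pspan Z (N p) (M p) p) 1.
Proof.
  intros HA HAg HAs Hneg Hq Hld eps Heps.
  set (Ts := tuples [true; false] (S K)). set (Q := INR (length Ts)).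
  assert (HQ : 0 <= Q) by apply pos_INR.
  set (e := eps / (2 * (Q * Q) + 1)).
  assert (He : 0 < e) by (apply Rdiv_lt_0_compat; nra).
  assert (Ee : e * (2 * (Q * Q) + 1) = eps) by (unfold e; field; nra).
  assert (E1 : ev (fun p => forall w, In w (list_prod Ts Ts) ->
     moment_term A (N p / S K) (M p / S K) p (fst w) (snd w) <=
       0 ^ ctrue (fst w) * 0 ^ ctrue (snd w) + e)).
  { apply ev_forall. intros [I J] Hw. apply in_prod_iff in Hw. destruct Hw.
    now apply (moment_term_small A K a b). }
  destruct Hld as (HN & HM & HlN & HlM).
  assert (E2 := ev_block_bounds a N K 1 HN HlN Rlt_0_1).
  assert (E3 := ev_block_bounds b M K 1 HM HlM Rlt_0_1).
  assert (E4 := ev_lt 1 Rlt_0_1).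
  cut (ev (fun p => Rabs (Pspan Z (N p) (M p) p - 1) < eps)); [auto |].
  eapply ev_impl; [|exact (ev_and _ _ E1 (ev_and _ _ E2 (ev_and _ _ E3 E4)))].
  clear E1 E2 E3 E4. intros p Hp (E1 & (E2 & E2' & _) & (E3 & E3' & _) & E4).
  assert (HL := Pspan_ge_second_moment Z A (S K) _ _ (N p) (M p) p
    HA (incl_grid_succ K A HAg) HAs E2 E3 E2' E3' ltac:(lra)).
  set (W := second_moment A (S K) (N p / S K) (M p / S K) p) in *.
  assert (HW : 0 < W) by (apply second_moment_pos; auto).
  assert (HWle : W <= 1 + Q * Q * e).
  { apply Rle_trans with (sum Ts (fun I => sum Ts (fun J => 0 ^ ctrue I * 0 ^ ctrue J + e))).
    - apply sum_le. intros I HI. apply sum_le. intros J HJ.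
      apply (E1 (I, J)). apply in_prod_iff. auto.
    - apply Req_le.
      rewrite (sum_ext Ts _ (fun I => 0 ^ ctrue I * 1 + Q * e)).
      + rewrite sum_add, sum_const.
        rewrite (sum_ext Ts _ (fun I => 0 ^ ctrue I)) by (intros; ring).
        unfold Ts at 1. rewrite sum_zero_pow_ctrue. unfold Q. ring.
      + intros I _. rewrite sum_add, sum_scal, sum_const. unfold Ts at 1.
        rewrite sum_zero_pow_ctrue. reflexivity. }
  assert (HP1 := Pspan_le_1 Z (N p) (M p) p ltac:(lra)).
  (* With [x = Q * Q * e], this follows from [W <= 1 + x] and [(1 - x) * (1 + x) <= 1]; for [x > 1]
     the left side is negative. *)
  assert (HWi : 1 - Q * Q * e <= / W).
  { apply (Rmult_le_reg_r W); auto. rewrite Rinv_l by lra.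
    assert (0 <= Q * Q * e) by (apply Rmult_le_pos; nra).
    set (x := Q * Q * e) in *. destruct (Rle_dec x 1); nra. }
  assert (0 <= Q * Q) by nra.
  apply Rabs_def1; nra.
Qed.

(** * Support of the rate *)

Lemma zero_set_origin Z : is_zero_set Z -> (exists x, Z x) -> Z (0, 0)%nat.
Proof.
  intros HZ [[x y] Hx]. destruct (HZ _ Hx) as (a & b & [H1 H2] & H). apply H.
  unfold inRect in *. simpl in *. lia.
Qed.

(** Moving left, and then down along the axis, the last point before entering [Z] is on the outer
    boundary. *)
Lemma outer_boundary_below (Z : pt -> Prop) u v :
  Z (0, 0)%nat -> ~ Z (u, v) ->
  exists u' v', (u' <= u)%nat /\ (v' <= v)%nat /\ outer_boundary Z (u', v').
Proof.
  intros H0. revert v. induction u as [|u IHu]; intros v.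
  - induction v as [|v IHv]; intros Hz; [contradiction |].
    destruct (classic (Z (0, v)%nat)) as [H|H].
    + exists 0%nat, (S v). repeat split; auto. right. now exists v.
    + destruct (IHv H) as (u' & v' & ? & ? & ?). exists u', v'. auto.
  - intros Hz. destruct (classic (Z (u, v))) as [H|H].
    + exists (S u), v. repeat split; auto. left. now exists u.
    + destruct (IHu v H) as (u' & v' & ? & ? & ?). exists u', v'. auto.
Qed.

Lemma card_le_1 l c : (forall x, In x l -> x = c) -> (card l <= 1)%nat.
Proof. intros H. apply (card_incl l [c]). intros x Hx. left. symmetry. auto. Qed.

Lemma finite_missing (A : list pt) : exists x, ~ In x A.
Proof.
  exists (S (list_max (map fst A)), 0%nat). intros H.
  assert (H1 := proj1 (list_max_le (map fst A) _) (Nat.le_refl _)).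
  rewrite Forall_forall in H1. apply (in_map fst), H1 in H. simpl in H. lia.
Qed.

(* If rho vanishes then, for (u, v) outside Z, no point sees both u points of A in its
   row and v in its column; hence A does not grow at all. *)
Lemma rho_pos_of_strict (Z : pt -> Prop) a b A :
  Z (0, 0)%nat -> quadrant a b ->
  (forall q, outer_boundary Z q ->
     0 < INR (fst q) * (1 - a) - b \/ 0 < INR (snd q) * (1 - b) - a) ->
  fin_spanning Z A -> 0 < rho a b A.
Proof.
  intros H0 [Ha Hb] Hstrict [HA Hs]. apply Rnot_le_lt. intros Hle.
  assert (Hval : forall B, NoDup B -> incl B A -> val a b B <= 0).
  { intros B HB Hi. assert (H := rho_ge a b A B HA HB Hi). lra. }
  destruct (finite_missing A) as [x Hx]. destruct (Hs x) as [t Ht].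
  apply Titer_stationary in Ht; [contradiction |].
  intros y [H|(_ & r & c & Hz & Hr & Hc)]; auto. exfalso.
  destruct (outer_boundary_below Z r c H0 Hz) as (u & v & Hu & Hv & Hq).
  apply (row_ge_mono _ (fun x => In x A) y y r u) in Hr; auto.
  apply (col_ge_mono _ (fun x => In x A) y y c v) in Hc; auto.
  destruct Hr as (lr & R1 & R2 & R3). destruct Hc as (lc & C1 & C2 & C3).
  specialize (Hstrict _ Hq). simpl in Hstrict. destruct Hstrict as [H|H].
  (* These [u] points use at most [u] columns and one row, so their value is at least
     [u (1 - a) - b], which is positive here. *)
  - assert (Hv' := Hval lr R2 (fun z Hz' => proj1 (R3 z Hz'))).
    assert (K1 := card_map_le_length fst lr).
    assert (K2 : (card (map snd lr) <= 1)%nat).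
    { apply (card_le_1 _ (snd y)). intros z Hz'. apply in_map_iff in Hz'.
      destruct Hz' as (w & <- & Hw). now apply R3. }
    unfold val in Hv'. rewrite R1 in *. apply le_INR in K1, K2. simpl in K2. nra.
  - assert (Hv' := Hval lc C2 (fun z Hz' => proj1 (C3 z Hz'))).
    assert (K1 := card_map_le_length snd lc).
    assert (K2 : (card (map fst lc) <= 1)%nat).
    { apply (card_le_1 _ (fst y)). intros z Hz'. apply in_map_iff in Hz'.
      destruct Hz' as (w & <- & Hw). now apply C3. }
    unfold val in Hv'. rewrite C1 in *. apply le_INR in K1, K2. simpl in K2. nra.
Qed.

(* [k] rows with [u] points each and [k] columns with [v] points each, no further two
   points sharing a line; the lines cross in the empty square [[0, k) x [0, k)]. *)
Definition combs (k u v : nat) : list pt :=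
  filter (fun q =>
    ((snd q <? k) && (k + snd q * u <=? fst q) && (fst q <? k + snd q * u + u)
     || (fst q <? k) && (k + fst q * v <=? snd q) && (snd q <? k + fst q * v + v))%nat%bool)
    (grid (k + k * u + k * v) (k + k * u + k * v)).

Lemma in_combs k u v x y : In (x, y) (combs k u v) <->
  ((y < k /\ k + y * u <= x < k + y * u + u) \/ (x < k /\ k + x * v <= y < k + x * v + v))%nat.
Proof.
  unfold combs. rewrite filter_In, in_grid. cbn [fst snd].
  rewrite Bool.orb_true_iff, !Bool.andb_true_iff, !Nat.ltb_lt, !Nat.leb_le.
  split; [tauto |]. intros [H|H].
  - assert (y * u + u <= k * u)%nat by nia. split; [split; nia | tauto].
  - assert (x * v + v <= k * v)%nat by nia. split; [split; nia | tauto].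
Qed.

(** Every point of the empty square sees [u] points in its row and [v] in its column, so the square
    fills in one step. *)
Lemma combs_spans k u v Z :
  bounded_by k Z -> ~ Z (u, v) -> spans Z (fun x => In x (combs k u v)).
Proof.
  intros Hk Hz. apply (spans_of_Titer Z _ 1), (spans_block k Z _ Hk).
  intros i j Hi Hj. apply (T_intro Z _ _ u v Hz).
  - apply (row_ge_intro _ i j (seq (k + j * u) u)); [apply seq_NoDup | now rewrite length_seq |].
    intros a Ha. apply in_seq in Ha. apply in_combs. left. lia.
  - apply (col_ge_intro _ i j (seq (k + i * v) v)); [apply seq_NoDup | now rewrite length_seq |].
    intros a Ha. apply in_seq in Ha. apply in_combs. right. lia.
Qed.

(** Let the horizontal part [B1] meet [s1] rows and the vertical part [B2] meet [f2] columns. Points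
    of [B1] lie in distinct columns, none of them used by [B2], and symmetrically for rows. So [val]
    is at most [(1 - a) |B1| + (1 - b) |B2| - b s1 - a f2]; then [|B1| <= u s1], [|B2| <= v f2] and
    [a, b <= 1] leave a combination of the two negative quantities. *)
Lemma combs_val_neg k u v a b B :
  0 <= a <= 1 -> 0 <= b <= 1 -> INR u * (1 - a) - b < 0 -> INR v * (1 - b) - a < 0 ->
  In B (sublists (combs k u v)) -> B <> [] -> val a b B < 0.
Proof.
  intros Ha Hb Hu Hv HB Hne.
  assert (HBn : NoDup B).
  { apply (sublists_NoDup (combs k u v)); auto. apply NoDup_filter, NoDup_grid. }
  apply sublists_incl in HB.
  set (f := fun q : pt => Nat.ltb (snd q) k).
  set (B1 := filter f B). set (B2 := filter (fun q => negb (f q)) B).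
  assert (HB1 : forall x y, In (x, y) B1 -> In (x, y) B /\
     (y < k /\ k + y * u <= x < k + y * u + u)%nat).
  { intros x y H. apply filter_In in H. destruct H as [H1 H2]. split; auto.
    apply HB, in_combs in H1. unfold f in H2. simpl in H2. apply Nat.ltb_lt in H2. lia. }
  assert (HB2 : forall x y, In (x, y) B2 -> In (x, y) B /\
     (x < k /\ k + x * v <= y < k + x * v + v)%nat).
  { intros x y H. apply filter_In in H. destruct H as [H1 H2]. split; auto.
    apply HB, in_combs in H1. unfold f in H2. simpl in H2.
    apply Bool.negb_true_iff, Nat.ltb_ge in H2. lia. }
  assert (Hdiv : forall w x y y', (k + y * w <= x < k + y * w + w)%nat ->
     (k + y' * w <= x < k + y' * w + w)%nat -> y = y').
  { intros w x y y' H1 H2. destruct (Nat.lt_total y y') as [H|[H|H]]; auto;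
    apply (Nat.mul_le_mono_r _ _ w) in H; simpl in H; lia. }
  assert (Hlen : (length B1 + length B2 = length B)%nat) by apply filter_length.
  assert (HB1n : NoDup B1) by now apply NoDup_filter.
  assert (HB2n : NoDup B2) by now apply NoDup_filter.
  clearbody B1 B2.
  assert (HF : (length B1 + card (map fst B2) <= card (map fst B))%nat).
  { assert (E : (length (map fst B1 ++ nodup Nat.eq_dec (map fst B2)) =
                 length B1 + card (map fst B2))%nat).
    { rewrite length_app. f_equal. apply length_map. }
    rewrite <- E. apply NoDup_incl_length.
    - apply NoDup_app; [|apply NoDup_nodup |].
      + apply FinFun.Injective_map_NoDup_in; auto.
        intros [x y] [x' y'] H1 H2 E'. simpl in E'. subst x'.
        apply HB1 in H1, H2. f_equal. apply (Hdiv u x); tauto.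
      + intros x H1 H2. apply nodup_In in H2. apply in_map_iff in H1, H2.
        destruct H1 as ([x1 y1] & E1 & H1). destruct H2 as ([x2 y2] & E2 & H2).
        apply HB1 in H1. apply HB2 in H2. simpl in *. lia.
    - intros x Hx. apply nodup_In. apply in_app_or in Hx. rewrite nodup_In in Hx.
      rewrite !in_map_iff in Hx. apply in_map_iff.
      destruct Hx as [([x' y'] & E' & H)|([x' y'] & E' & H)]; exists (x', y');
      split; auto; [now apply HB1 | now apply HB2]. }
  assert (HS : (length B2 + card (map snd B1) <= card (map snd B))%nat).
  { assert (E : (length (map snd B2 ++ nodup Nat.eq_dec (map snd B1)) =
                 length B2 + card (map snd B1))%nat).
    { rewrite length_app. f_equal. apply length_map. }
    rewrite <- E. apply NoDup_incl_length.
    - apply NoDup_app; [|apply NoDup_nodup |].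
      + apply FinFun.Injective_map_NoDup_in; auto.
        intros [x y] [x' y'] H1 H2 E'. simpl in E'. subst y'.
        apply HB2 in H1, H2. f_equal. apply (Hdiv v y); tauto.
      + intros x H1 H2. apply nodup_In in H2. apply in_map_iff in H1, H2.
        destruct H1 as ([x1 y1] & E1 & H1). destruct H2 as ([x2 y2] & E2 & H2).
        apply HB2 in H1. apply HB1 in H2. simpl in *. lia.
    - intros x Hx. apply nodup_In. apply in_app_or in Hx. rewrite nodup_In in Hx.
      rewrite !in_map_iff in Hx. apply in_map_iff.
      destruct Hx as [([x' y'] & E' & H)|([x' y'] & E' & H)]; exists (x', y');
      split; auto; [now apply HB2 | now apply HB1]. }
  assert (H1 : (length B1 <= u * card (map snd B1))%nat).
  { assert (E : (length (map (fun w => (k + snd w * u + fst w, snd w))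
       (list_prod (seq 0 u) (nodup Nat.eq_dec (map snd B1)))) = u * card (map snd B1))%nat).
    { now rewrite length_map, length_prod, length_seq. }
    rewrite <- E. apply NoDup_incl_length; auto. intros [x y] H.
    apply in_map_iff. exists (x - (k + y * u), y)%nat. apply (in_map snd) in H as Hy.
    apply HB1 in H. split.
    - simpl. f_equal. lia.
    - apply in_prod_iff. rewrite in_seq, nodup_In. split; auto. lia. }
  assert (H2 : (length B2 <= v * card (map fst B2))%nat).
  { assert (E : (length (map (fun w => (snd w, k + snd w * v + fst w))
       (list_prod (seq 0 v) (nodup Nat.eq_dec (map fst B2)))) = v * card (map fst B2))%nat).
    { now rewrite length_map, length_prod, length_seq. }
    rewrite <- E. apply NoDup_incl_length; auto. intros [x y] H.
    apply in_map_iff. exists (y - (k + x * v), x)%nat. apply (in_map fst) in H as Hx.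
    apply HB2 in H. split.
    - simpl. f_equal. lia.
    - apply in_prod_iff. rewrite in_seq, nodup_In. split; auto. lia. }
  (* Strictness: a nonempty [B] gives one of the two negative quantities a positive coefficient. *)
  assert (H3 : (1 <= card (map snd B1) + card (map fst B2))%nat).
  { destruct B as [|q0 B0]; [congruence |]. simpl in Hlen.
    destruct (card (map snd B1)); [|lia]. destruct (card (map fst B2)); lia. }
  unfold val. rewrite <- Hlen.
  apply le_INR in HF, HS, H1, H2, H3. rewrite ?plus_INR, ?mult_INR in *. simpl in H3.
  assert (P1 := pos_INR (card (map snd B1))). assert (P2 := pos_INR (card (map fst B2))).
  set (s1 := INR (card (map snd B1))) in *. set (f2 := INR (card (map fst B2))) in *.
  set (l1 := INR (length B1)) in *. set (l2 := INR (length B2)) in *.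
  apply (Rmult_le_compat_l a) in HF; [|lra]. apply (Rmult_le_compat_l b) in HS; [|lra].
  apply (Rmult_le_compat_l (1 - a)) in H1; [|lra]. apply (Rmult_le_compat_l (1 - b)) in H2; [|lra].
  assert (Hlt : s1 * (INR u * (1 - a) - b) + f2 * (INR v * (1 - b) - a) < 0).
  { destruct (Rle_lt_or_eq_dec _ _ P1) as [Q1|Q1]; [nra |]. assert (0 < f2) by lra.
    rewrite <- Q1. nra. }
  lra.
Qed.

Lemma not_predicted_support Z a b :
  unit_square a b -> ~ predicted_support Z a b ->
  exists u v, outer_boundary Z (u, v) /\
    INR u * (1 - a) - b < 0 /\ INR v * (1 - b) - a < 0.
Proof.
  intros Hs Hn. apply NNPP. intros H. apply Hn. split; auto. intros [u v] Hq. simpl.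
  apply Rle_ge, Rnot_lt_le. intros Hlt. apply H. exists u, v.
  assert (M1 := Rmax_l (INR u * (1 - a) - b) (INR v * (1 - b) - a)).
  assert (M2 := Rmax_r (INR u * (1 - a) - b) (INR v * (1 - b) - a)).
  repeat split; [apply Hq | apply Hq | lra | lra].
Qed.

Lemma rate_nonpos Z K u v a b :
  finite_set Z -> small_copies Z K -> unit_square a b -> ~ Z (u, v) ->
  INR u * (1 - a) - b < 0 -> INR v * (1 - b) - a < 0 ->
  rate (small_spanning Z K) a b <= 0.
Proof.
  intros Hf HK [Ha Hb] Hz Hu Hv. destruct (finite_bounded Z Hf) as [k Hk].
  eapply Rle_trans; [apply (rate_le_spanning Z K a b (combs k u v) HK) |].
  - split; lra.
  - split; [apply NoDup_filter, NoDup_grid | now apply combs_spans].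
  - destruct (rho_attained a b (combs k u v)) as (B & HB & ->).
    destruct B as [|q B]; [rewrite val_nil; lra |].
    left. apply (combs_val_neg k u v); auto. discriminate.
Qed.

Lemma support_in_predicted Z K a b :
  finite_set Z -> small_copies Z K ->
  support_unit (rate (small_spanning Z K)) a b -> predicted_support Z a b.
Proof.
  intros Hf HK Hs.
  assert (Hsq : unit_square a b).
  { assert (H : forall eps, eps > 0 -> -eps < a < 1 + eps /\ -eps < b < 1 + eps).
    { intros eps Heps. destruct (Hs eps Heps) as (a' & b' & [H1 H2] & _ & H3 & H4).
      apply Rabs_def2 in H3, H4. lra. }
    (* A coordinate outside [[0, 1]] is refuted by taking [eps] equal to its distance from the
       interval. *)
    repeat split; apply Rnot_lt_le; intros Hlt.
    - specialize (H (- a)). lra.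
    - specialize (H (a - 1)). lra.
    - specialize (H (- b)). lra.
    - specialize (H (b - 1)). lra. }
  apply NNPP. intros Hn.
  destruct (not_predicted_support Z a b Hsq Hn) as (u & v & [Hz _] & Hu & Hv).
  (* [g] is the margin by which both inequalities fail. Moving each coordinate by less than [eps]
     changes the expressions by less than [eps (u + 1)] and [eps (v + 1)], at most [g], so nearby
     points of the square still have rate at most 0. *)
  set (g := Rmin (- (INR u * (1 - a) - b)) (- (INR v * (1 - b) - a))).
  assert (Hg : 0 < g) by (apply Rmin_glb_lt; lra).
  assert (M1 := Rmin_l (- (INR u * (1 - a) - b)) (- (INR v * (1 - b) - a))).
  assert (M2 := Rmin_r (- (INR u * (1 - a) - b)) (- (INR v * (1 - b) - a))).
  fold g in M1, M2. clearbody g.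
  assert (Pu := pos_INR u). assert (Pv := pos_INR v).
  set (eps := g / (INR u + INR v + 1)).
  assert (Heps : 0 < eps) by (apply Rdiv_lt_0_compat; lra).
  assert (Ee : eps * (INR u + INR v + 1) = g) by (unfold eps; field; lra).
  clearbody eps.
  destruct (Hs eps Heps) as (a' & b' & Hsq' & Hpos & H1 & H2).
  apply Rabs_def2 in H1, H2.
  assert (rate (small_spanning Z K) a' b' <= 0); [|lra].
  apply (rate_nonpos Z K u v); auto; nra.
Qed.

(* Shrinking (a, b) towards the origin makes every boundary condition strict. *)
Lemma predicted_in_support Z K a b :
  finite_set Z -> small_copies Z K -> Z (0, 0)%nat ->
  predicted_support Z a b -> support_unit (rate (small_spanning Z K)) a b.
Proof.
  intros Hf HK H0 [[Ha Hb] Hp] eps Heps.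
  set (e := Rmin (eps / 2) (1 / 2)).
  assert (He : 0 < e) by (apply Rmin_glb_lt; lra).
  assert (M1 := Rmin_l (eps / 2) (1 / 2)). assert (M2 := Rmin_r (eps / 2) (1 / 2)).
  fold e in M1, M2. clearbody e.
  exists ((1 - e) * a), ((1 - e) * b).
  assert (Hsq : unit_square ((1 - e) * a) ((1 - e) * b)) by (split; split; nra).
  split; auto. split; [|split; apply Rabs_def1; nra].
  destruct (rate_attained _ ((1 - e) * a) ((1 - e) * b) (small_spanning_nonempty Z K Hf HK))
    as (A & HA & ->).
  apply (rho_pos_of_strict Z); auto.
  - split; apply Hsq.
  - intros [u v] Hq. assert (Hq' := Hp _ Hq). cbn [fst snd] in *.
    assert (Pu := pos_INR u). assert (Pv := pos_INR v).
    assert (Hor : 0 <= INR u * (1 - a) - b \/ 0 <= INR v * (1 - b) - a).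
    { unfold Rmax in Hq'. destruct Rle_dec; [right | left]; lra. }
    destruct Hor as [H|H].
    (* For [u = 0] shrinking cannot make this term strict. But then [b = 0], and [v > 0] because the
       origin is in [Z], so the other term is strict. *)
    + destruct u as [|u].
      * right. simpl in H. destruct v as [|v]; [destruct Hq as [Hq _]; contradiction |].
        rewrite S_INR in *. assert (Pv' := pos_INR v). assert (b = 0) by lra. subst b. nra.
      (* The term is affine, so its new value mixes the old nonnegative one with its positive value
         at the origin. *)
      * left. rewrite S_INR in *. assert (Pu' := pos_INR u).
        replace ((INR u + 1) * (1 - (1 - e) * a) - (1 - e) * b) with
          ((1 - e) * ((INR u + 1) * (1 - a) - b) + e * (INR u + 1)) by ring. nra.
    + destruct v as [|v].
      * left. simpl in H. destruct u as [|u]; [destruct Hq as [Hq _]; contradiction |].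
        rewrite S_INR in *. assert (Pu' := pos_INR u). assert (a = 0) by lra. subst a. nra.
      * right. rewrite S_INR in *. assert (Pv' := pos_INR v).
        replace ((INR v + 1) * (1 - (1 - e) * b) - (1 - e) * a) with
          ((1 - e) * ((INR v + 1) * (1 - b) - a) + e * (INR v + 1)) by ring. nra.
  - now apply (small_spanning_fin Z K).
Qed.

Theorem mainTheorem3 (Z : pt -> Prop)
  (HZ : is_zero_set Z) (Hfin : finite_set Z) (Hne : exists x, Z x) :
  exists I : R -> R -> R,
    (forall alpha beta, quadrant alpha beta -> rate_is Z alpha beta (I alpha beta)) /\
    (exists A0 : list (list pt),
       (forall A, In A A0 -> fin_spanning Z A) /\
       forall alpha beta, quadrant alpha beta ->
         (forall A, fin_spanning Z A -> I alpha beta <= rho alpha beta A) /\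
         (exists A, In A A0 /\ I alpha beta = rho alpha beta A)) /\
    continuous_quadrant I /\
    piecewise_linear_quadrant I /\
    (forall a a' b, quadrant a b -> a <= a' -> I a' b <= I a b) /\
    (forall a b b', quadrant a b -> b <= b' -> I a b' <= I a b) /\
    concave_on_triangle I /\
    (exists g, gamma_spec Z g /\ I 0 0 = INR g /\
       forall a b, quadrant a b -> (a, b) <> (0, 0) -> I a b < INR g) /\
    (forall a b, support_unit I a b <-> predicted_support Z a b) /\
    (forall a b, unit_square a b -> ~ predicted_support Z a b ->
       forall N M, ld_regime a b N M -> lim0 (fun p => Pspan Z (N p) (M p) p) 1).
Proof.
  assert (H0 := zero_set_origin Z HZ Hne).
  destruct (small_copies_exist Z Hfin) as [K HK].
  assert (Hne0 := small_spanning_nonempty Z K Hfin HK).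
  exists (rate (small_spanning Z K)).
  split; [intros; now apply rate_is_rate |].
  split.
  { exists (small_spanning Z K). split; [apply small_spanning_fin |].
    intros a b Hq. split; [intros; now apply (rate_le_spanning Z K) | now apply rate_attained]. }
  split; [now apply rate_continuous |].
  split; [now apply rate_piecewise_linear |].
  split; [intros; apply rate_antitone; auto; lra |].
  split; [intros; apply rate_antitone; auto; lra |].
  split; [now apply rate_concave |].
  split; [now apply rate_zero_gamma |].
  split.
  { intros a b. split; [now apply support_in_predicted | now apply predicted_in_support]. }
  intros a b Hsq Hn N M Hld.
  destruct (not_predicted_support Z a b Hsq Hn) as (u & v & [Hz _] & Hu & Hv).
  destruct (finite_bounded Z Hfin) as [k Hk]. destruct Hsq as [Ha Hb].
  apply (Pspan_to_1 Z (combs k u v) (k + k * u + k * v) a b); auto.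
  - apply NoDup_filter, NoDup_grid.
  - apply incl_filter.
  - now apply combs_spans.
  - intros B. now apply combs_val_neg.
  - split; lra.
Qed.
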